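(* The image of the map $\iota:K(1,6)\to K(1,6)$, $\iota(f)=f+A(f)$, is a Lie subalgebra (sub-superalgebra) of $K(1,6)$ isomorphic to $E(1,6)$.
   Context: All spaces are over $\mathbb C$. **$K(1,6)$.** $K(1,6)=\mathbb C[[t]]\otimes\bigwedge(\xi_1,\xi_2,\xi_3,\eta_1,\eta_2,\eta_3)$ ($t$ even, $\xi_i,\eta_i$ odd, $p$ = parity) with bracket $$[f,g]=(2-E)f\,\frac{\partial g}{\partial t}-\frac{\partial f}{\partial t}(2-E)g+(-1)^{p(f)}\sum_{i=1}^3\Big(\frac{\partial f}{\partial\xi_i}\frac{\partial g}{\partial\eta_i}+\frac{\partial f}{\partial\eta_i}\frac{\partial g}{\partial\xi_i}\Big),\quad E=\sum_{i=1}^3\Big(\xi_i\frac{\partial}{\partial\xi_i}+\eta_i\frac{\partial}{\partial\eta_i}\Big).$$ Put $\xi_4=\eta_1$, $\eta_4=\xi_1$, so the odd generators are also $\xi_2,\xi_3,\xi_4,\eta_2,\eta_3,\eta_4$. Write $\xi_{\bar i}=\eta_i$ and $\bar{\bar i}=i$. For a sequence $I=(i_1,\dots,i_k)$ with distinct entries in $\{2,3,4,\bar2,\bar3,\bar4\}$ let $|I|=k$, $\xi_I=\xi_{i_1}\cdots\xi_{i_k}$, $\bar I=(\bar i_1,\dots,\bar i_k)$, and let $\xi_I^\#$ be the unique signed monomial with $\xi_{\bar I}\,\xi_I^\#=\xi_2\xi_3\xi_4\eta_2\eta_3\eta_4$. **$A$.** $A:K(1,6)\to K(1,6)$ is the (continuous)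 linear operator with $A(t^n\xi_I)=(-1)^{|I|(|I|+1)/2}(\partial_t^{3-|I|}t^n)\,\xi_I^\#$, where $\partial_t^{-1}=\int_0^t$ and negative powers are iterated integrals. **$E(1,6)$.** Identify $\mathbb C^4=\sum_{i=2}^5\mathbb Cx_i$, $S^2(\mathbb C^4)$ with quadratic forms in $x_2,\dots,x_5$, $\bigwedge^2(\mathbb C^4)$ with constant-coefficient 2-forms in $x_2,\dots,x_5$, and $\mathfrak{sl}_4$ with zero-divergence vector fields $\sum_{i,j=2}^5b_{ij}x_i\partial_j$. For a $k$-form $\omega$ ($k\geq 1$) in these variables with coefficients homogeneous polynomials of degree $m$, put $\int\omega=\frac1{k+m}i_{\mathcal E}\omega$, $\mathcal E=\sum_{j=2}^5x_j\partial_j$. As a vector superspace, $$E(1,6)_{\bar0}=W_1\oplus(\mathfrak{sl}_4\otimes\mathbb C[[t]]),\qquad E(1,6)_{\bar1}=(S^2(\mathbb C^4)\otimes\mathbb C[[t]]dt)\oplus(\textstyle\bigwedge^2(\mathbb C^4)\otimes\mathbb C[[t]]dt),$$ with $W_1=\mathbb C[[t]]\partial_t$. Brackets, for $f,g\in\mathbb C[[t]]$, $X,Y\in\mathfrak{sl}_4$, $p,q\in S^2(\mathbb C^4)$, $\sigma,\omega\in\bigwedge^2(\mathbb C^4)$: - $[f\partial_t,g\partial_t]=(fg'-f'g)\partial_t$, $[X\otimes f,Y\otimes g]=[X,Y]\otimes fg$, $[f\partial_t,X\otimes g]=X\otimes fg'$; - $[f\partial_t,p\otimes g\,dt]=p\otimes((fg)'-\frac12f'g)dt$,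 $[f\partial_t,\omega\otimes g\,dt]=\omega\otimes((fg)'-\frac32f'g)dt$; - $[X\otimes f,p\otimes g\,dt]=X(p)\otimes fg\,dt$, $[X\otimes f,\omega\otimes g\,dt]=\int(i_X\omega)\otimes f'g\,dt+L_X\omega\otimes fg\,dt$; - $[p\otimes f\,dt,q\otimes g\,dt]=0$, $[p\otimes f\,dt,\omega\otimes g\,dt]=-(dp\wedge\omega)\otimes fg\in\mathfrak{sl}_4\otimes\mathbb C[[t]]$; - $[\sigma\otimes f\,dt,\omega\otimes g\,dt]=fg(\sigma\wedge\omega)+\frac12\big((\int\sigma)\wedge\omega-\sigma\wedge\int\omega\big)\otimes(fg'-f'g)\in W_1\oplus(\mathfrak{sl}_4\otimes\mathbb C[[t]])$. Here a closed 3-form in $x_2,\dots,x_5$ is identified with the zero-divergence vector field $X$ such that the form equals $i_X(dx_2\wedge dx_3\wedge dx_4\wedge dx_5)$, and $fg\cdot c\,dx_2\wedge dx_3\wedge dx_4\wedge dx_5$ ($c\in\mathbb C$) is identified with $c\,fg\,\partial_t$. *)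

(* Defs.v *)
From mathcomp Require Import boolp functions reals.
From HB Require Import structures.
From mathcomp Require Import all_boot all_order all_algebra.
From mathcomp Require Import complex mpoly ring.

Set Implicit Arguments.
Unset Strict Implicit.
Unset Printing Implicit Defensive.
Import GRing.Theory Num.Theory.
Local Open Scope ring_scope.

Section ExteriorAlgebra.
Variables (A : comNzRingType) (n : nat).
Local Notation ext := {ffun {set 'I_n} -> A}.
Implicit Types (S T V : {set 'I_n}) (u v w : ext).

(* Exterior algebra on n odd generators e_0, ..., e_(n-1) over A: the element u
   is the sum over S = {i_1 < ... < i_k} of u S * e_(i_1) ... e_(i_k). *)
Definition mon S : ext := [ffun T : {set 'I_n} => (T == S)%:R].

(* The sign of e_S e_T is (-1) ^+ ninv S T when S and T are disjoint. *)
Definition ninv S T : nat := \sum_(i in S) #|[set j in T | (j < i)%N]|.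

Definition wedge u v : ext :=
  [ffun S : {set 'I_n} => \sum_(T : {set 'I_n} | T \subset S)
     (-1) ^+ ninv T (S :\: T) * (u T * v (S :\: T))].

(* Left derivative with respect to e_j. *)
Definition dpart (j : 'I_n) u : ext :=
  [ffun S : {set 'I_n} => if j \in S then 0
     else (-1) ^+ #|[set k in S | (k < j)%N]| * u (j |: S)].

Definition wedge_seq (s : seq 'I_n) : ext :=
  foldr (fun i u => wedge (mon [set i]) u) (mon set0) s.

Definition ext_deg (k : nat) u := forall S, #|S| != k -> u S = 0.

Lemma card_setIdE T (i : nat) :
  #|[set j in T | (j < i)%N]| = (\sum_(j in T) (j < i))%N.
Proof.
rewrite -sum1_card big_mkcond [RHS]big_mkcond /=; apply: eq_bigr => j _.
by rewrite inE; case: (j \in T); case: (j < i)%N.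
Qed.

Lemma ninvE S T : ninv S T = (\sum_(i in S) \sum_(j in T) (j < i))%N.
Proof. by apply: eq_bigr => i _; rewrite card_setIdE. Qed.

Lemma sum_setU_disjoint S V (F : 'I_n -> nat) : [disjoint S & V] ->
  (\sum_(i in S :|: V) F i = \sum_(i in S) F i + \sum_(i in V) F i)%N.
Proof.
by move=> dS; rewrite -bigU //; apply: eq_bigl => i; rewrite !inE.
Qed.

Lemma ninvUl S V T : [disjoint S & V] ->
  ninv (S :|: V) T = (ninv S T + ninv V T)%N.
Proof. exact: sum_setU_disjoint. Qed.

Lemma ninvUr S T V : [disjoint T & V] ->
  ninv S (T :|: V) = (ninv S T + ninv S V)%N.
Proof.
move=> dT; rewrite !ninvE -big_split /=; apply: eq_bigr => i _.
exact: sum_setU_disjoint.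
Qed.

Lemma ninvC S T : [disjoint S & T] -> (ninv S T + ninv T S = #|S| * #|T|)%N.
Proof.
move=> dST; rewrite !ninvE [X in (_ + X)%N]exchange_big /= -big_split /=.
rewrite -sum_nat_const; apply: eq_bigr => i iS.
rewrite -big_split /= -sum1_card; apply: eq_bigr => j jT.
case: ltngtP => // /val_inj eij; move/pred0P/(_ i): dST => /=.
by rewrite iS -eij jT.
Qed.

Lemma wedgeA u v w : wedge u (wedge v w) = wedge (wedge u v) w.
Proof.
apply/ffunP => S; rewrite !ffunE.
under eq_bigr do rewrite ffunE !mulr_sumr.
under [RHS]eq_bigr do rewrite ffunE mulr_suml mulr_sumr.
rewrite [RHS](exchange_big_dep (fun T : {set 'I_n} => T \subset S)) /=; last first.
  by move=> Q T QS TQ; apply: subset_trans QS.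
apply: eq_bigr => T TS.
rewrite [RHS](reindex_onto (fun V : {set 'I_n} => T :|: V)
                           (fun Q : {set 'I_n} => Q :\: T)) /=; last first.
  move=> Q /andP[_ TQ]; apply/setP => x; rewrite !inE.
  by case xT: (x \in T) => //=; rewrite (subsetP TQ).
apply: eq_big => [V|V].
  rewrite subsetD subUset TS finset.subsetUl /= andbT.
  congr (_ && _); rewrite setDUl setDv set0U eqEsubset subsetDl /= subsetD.
  by rewrite subxx.
rewrite subsetD => /andP[VS dVT].
have dTV : [disjoint T & V] by rewrite disjoint_sym.
have -> : (T :|: V) :\: T = V.
  by rewrite setDUl setDv set0U; apply/setDidPl.
rewrite -setDDl.
set W := (S :\: T) :\: V.
have -> : S :\: T = V :|: W.
  rewrite /W; apply/setP => x; rewrite !inE.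
  by case xV: (x \in V) => //=; rewrite (subsetP VS) // (disjointFr dVT).
have dVW : [disjoint V & W].
  by rewrite -setI_eq0; apply/eqP/setP => x; rewrite !inE; case: (x \in V).
rewrite ninvUr // ninvUl // !exprD.
set a := (-1) ^+ _; set b := (-1) ^+ _; set c := (-1) ^+ _.
by ring.
Qed.

Lemma wedgeC k l u v : ext_deg k u -> ext_deg l v ->
  wedge u v = [ffun S => (-1) ^+ (k * l) * wedge v u S].
Proof.
move=> hu hv; apply/ffunP => S; rewrite !ffunE mulr_sumr.
rewrite (reindex_onto (fun T => S :\: T) (fun T => S :\: T)) /=; last first.
  by move=> T TS; rewrite setDDr setDv set0U; apply/setIidPr.
apply: eq_big => [T|T /andP[_ /eqP eT]].
  rewrite subsetDl /= setDDr setDv set0U.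
  by apply/eqP/idP => [<-|/setIidPr //]; rewrite subsetIl.
rewrite eT; have [cT|/hv->] := eqVneq #|T| l; last by rewrite !(mul0r, mulr0).
have [cS|/hu->] := eqVneq #|S :\: T| k; last by rewrite !(mul0r, mulr0).
have dT : [disjoint S :\: T & T].
  by rewrite -setI_eq0; apply/eqP/setP => x; rewrite !inE; case: (x \in T); rewrite ?andbF.
rewrite mulrA (mulrC (u _)); congr (_ * _).
by rewrite -cS -cT -(ninvC dT) exprD -mulrA -expr2 sqrr_sign mulr1.
Qed.

Lemma wedgeDl u v w : wedge (u + v) w = wedge u w + wedge v w.
Proof.
apply/ffunP => S; rewrite !ffunE -big_split; apply: eq_bigr => T _ /=.
by rewrite ffunE mulrDl mulrDr.
Qed.

Lemma wedgeDr u v w : wedge w (u + v) = wedge w u + wedge w v.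
Proof.
apply/ffunP => S; rewrite !ffunE -big_split; apply: eq_bigr => T _ /=.
by rewrite ffunE mulrDr mulrDr.
Qed.

Lemma wedge0l w : wedge 0 w = 0.
Proof. by apply: (addrI (wedge 0 w)); rewrite -wedgeDl !addr0. Qed.

Lemma wedge0r w : wedge w 0 = 0.
Proof. by apply: (addrI (wedge w 0)); rewrite -wedgeDr !addr0. Qed.

Lemma wedgeNl u w : wedge (- u) w = - wedge u w.
Proof. by apply: (addrI (wedge u w)); rewrite -wedgeDl !subrr wedge0l. Qed.

Lemma wedgeNr u w : wedge w (- u) = - wedge w u.
Proof. by apply: (addrI (wedge w u)); rewrite -wedgeDr !subrr wedge0r. Qed.

Lemma wedge_suml (I : Type) (r : seq I) (P : pred I) (F : I -> ext) w :
  wedge (\sum_(i <- r | P i) F i) w = \sum_(i <- r | P i) wedge (F i) w.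
Proof.
by apply: (big_morph (wedge^~ w)) => [u v|]; [exact: wedgeDl|exact: wedge0l].
Qed.

Lemma wedge_sumr (I : Type) (r : seq I) (P : pred I) (F : I -> ext) w :
  wedge w (\sum_(i <- r | P i) F i) = \sum_(i <- r | P i) wedge w (F i).
Proof.
by apply: (big_morph (wedge w)) => [u v|]; [exact: wedgeDr|exact: wedge0r].
Qed.

Lemma wedge_mon1 j u S :
  wedge (mon [set j]) u S =
  if j \in S then (-1) ^+ #|[set k in S | (k < j)%N]| * u (S :\ j) else 0.
Proof.
rewrite ffunE; case: ifPn => jS; last first.
  rewrite big1 // => T TS; rewrite ffunE; case: eqP => [eT|]; last first.
    by rewrite mul0r mulr0.
  by rewrite eT sub1set (negPf jS) in TS.
rewrite (bigD1 [set j]) ?sub1set //= ffunE eqxx mul1r big1 ?addr0; last first.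
  by move=> T /andP[_ /negPf nT]; rewrite ffunE nT mul0r mulr0.
congr (_ ^+ _ * _); rewrite /ninv big_set1; apply: eq_card => k.
by rewrite !inE; case: eqP => //= ->; rewrite ltnn andbF.
Qed.

End ExteriorAlgebra.

Section PolynomialForms.
Variables (K : numFieldType) (n : nat).
Local Notation poly := {mpoly K[n]}.
Local Notation vfield := {ffun 'I_n -> poly}.
Local Notation form := {ffun {set 'I_n} -> poly}.
Implicit Types (p q : poly) (X Y : vfield) (u v w : form) (S T : {set 'I_n}).

(* The vector field X is \sum_j X j * d/dx_j; a form has polynomial coefficients
   and the generators e_j of the exterior algebra stand for the dx_j. *)
Definition vf_app X p : poly := \sum_j X j * p^`M(j).

Definition vf_bracket X Y : vfield :=
  [ffun j => vf_app X (Y j) - vf_app Y (X j)].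

Definition vf_div X : poly := \sum_j (X j)^`M(j).

Definition vf_linear X : bool := [forall j, X j \is 1.-homog].

Definition form0 p : form := [ffun S : {set 'I_n} => if S == set0 then p else 0].

Definition contr X w : form :=
  [ffun S : {set 'I_n} => \sum_j X j * dpart j w S].

Definition form_pder j w : form := [ffun S : {set 'I_n} => (w S)^`M(j)].

Definition extd w : form := \sum_j wedge (mon _ [set j]) (form_pder j w).

Definition lieD X w : form := contr X (extd w) + extd (contr X w).

Definition euler : vfield := [ffun j => 'X_j].

(* Meant for k-forms whose coefficients are homogeneous of degree m. *)
Definition form_int (k m : nat) w : form := (k + m)%:R^-1 *: contr euler w.

Definition is_form (k m : nat) w : bool :=
  [forall S : {set 'I_n}, if #|S| == k then w S \is m.-homog else w S == 0].

(* Inverse of X |-> i_X (dx_0 ... dx_(n-1)) on (n-1)-forms, see vf_of_formK. *)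
Definition vf_of_form w : vfield :=
  [ffun j : 'I_n => (-1) ^+ j * w [set~ j]].

Lemma is_formP k m w :
  reflect ((forall S, #|S| = k -> w S \is m.-homog) /\ ext_deg k w)
          (is_form k m w).
Proof.
apply: (iffP forallP) => [h|[h1 h2] S].
  split=> S; first by move=> cS; have:= h S; rewrite cS eqxx.
  by move=> cS; have:= h S; rewrite (negPf cS) => /eqP.
by case: eqVneq => [/h1 //|/h2->].
Qed.

Lemma is_form_homog k m w S : is_form k m w -> w S \is m.-homog.
Proof.
move=> /is_formP[h1 h2]; have [/h1 //|/h2->] := eqVneq #|S| k.
exact: rpred0.
Qed.

Lemma is_form_deg k m w : is_form k m w -> ext_deg k w.
Proof. by case/is_formP. Qed.

Lemma is_form_submod k m : submod_closed (is_form k m : pred form).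
Proof.
split=> [|a u v hu hv]; apply/is_formP; split=> S cS.
- by rewrite ffunE rpred0.
- by rewrite ffunE.
- by rewrite !ffunE rpredD ?rpredZ ?(is_form_homog _ hu) ?(is_form_homog _ hv).
- by rewrite !ffunE (is_form_deg hu) // (is_form_deg hv) // scaler0 addr0.
Qed.

Lemma mderiv_homog m j p : p \is m.+1.-homog -> p^`M(j) \is m.-homog.
Proof.
move=> /dhomogP hp; apply/dhomogP => mm; rewrite mcoeff_msupp mcoeff_mderiv => nz.
have : (mm + U_(j))%MM \in msupp p.
  by rewrite mcoeff_msupp; apply: contraNneq nz => ->; rewrite mul0rn.
by move/hp; rewrite /= mdegD mdeg1 addn1 => -[].
Qed.

Lemma mderiv_homog0 j p : p \is 0.-homog -> p^`M(j) = 0.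
Proof.
move=> hp; apply/mpolyP => mm; rewrite mcoeff_mderiv mcoeff0.
by rewrite (dhomog_nemf_coeff hp) ?mul0rn //= mdegD mdeg1 addn1.
Qed.

Lemma wedge_form k m l b u v : is_form k m u -> is_form l b v ->
  is_form (k + l) (m + b) (wedge u v).
Proof.
move=> hu hv; apply/is_formP; split=> S cS; rewrite ffunE.
  apply: rpred_sum => T _; rewrite -signr_odd mulr_sign.
  have h : u T * v (S :\: T) \is (m + b).-homog.
    by apply: dhomogM; [exact: is_form_homog hu | exact: is_form_homog hv].
  by case: ifP; rewrite ?rpredN.
apply: big1 => T TS.
have [cT|cT] := eqVneq #|T| k; last by rewrite (is_form_deg hu) // mul0r mulr0.
rewrite (is_form_deg hv) ?mulr0 //; apply: contraNneq cS => <-.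
by rewrite -cT cardsD (setIidPr TS) subnKC // subset_leq_card.
Qed.

Lemma dpart_homog k m j w S : is_form k m w -> dpart j w S \is m.-homog.
Proof.
move=> hw; rewrite ffunE; case: ifP => _; first exact: rpred0.
rewrite -signr_odd mulr_sign; case: ifP => _; rewrite ?rpredN;
exact: is_form_homog hw.
Qed.

Lemma contr_form k m X w : vf_linear X -> is_form k.+1 m w ->
  is_form k m.+1 (contr X w).
Proof.
move=> /forallP hX hw; apply/is_formP; split=> S cS; rewrite ffunE.
  apply: rpred_sum => j _; rewrite -add1n; apply: dhomogM => //.
  exact: dpart_homog hw.
apply: big1 => j _; rewrite ffunE; case: ifPn => [_|jS]; first by rewrite mulr0.
by rewrite (is_form_deg hw) ?mulr0 // cardsU1 jS add1n eqSS.
Qed.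

Lemma euler_linear : vf_linear euler.
Proof. by apply/forallP => j; rewrite ffunE dhomogX /= mdeg1. Qed.

Lemma mon1_form j : is_form 1 0 (mon _ [set j]).
Proof.
apply/is_formP; split=> S cS; rewrite ffunE.
  by case: eqP => _ /=; rewrite ?dhomog1 ?rpred0.
by have [eS|_ //] := eqVneq S [set j]; rewrite eS cards1 in cS.
Qed.

Lemma form_pder_form k m j w : is_form k m.+1 w -> is_form k m (form_pder j w).
Proof.
move=> hw; apply/is_formP; split=> S cS; rewrite ffunE.
  by apply: mderiv_homog; exact: is_form_homog hw.
by rewrite (is_form_deg hw) // linear0.
Qed.

Lemma form_pder_const k j w : is_form k 0 w -> form_pder j w = 0.
Proof.
move=> hw; apply/ffunP => S; rewrite !ffunE.
by apply: mderiv_homog0; exact: is_form_homog hw.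
Qed.

Lemma extd_const k w : is_form k 0 w -> extd w = 0.
Proof.
by move=> hw; rewrite /extd big1 // => j _; rewrite (form_pder_const _ hw) wedge0r.
Qed.

HB.instance Definition _ k m :=
  GRing.isSubmodClosed.Build K form (is_form k m : pred form) (is_form_submod k m).

Lemma extd_form k m w : is_form k m.+1 w -> is_form k.+1 m (extd w).
Proof.
move=> hw; change (extd w \in (is_form k.+1 m : pred form)).
apply: rpred_sum => j _; rewrite -add1n -[m]add0n; change (is_form (1 + k) (0 + m) (wedge (mon _ [set j]) (form_pder j w))).
by apply: wedge_form; [exact: mon1_form | exact: form_pder_form].
Qed.

Lemma form0_form m p : p \is m.-homog -> is_form 0 m (form0 p).
Proof.
move=> hp; apply/is_formP; split=> S cS; rewrite ffunE.
  by rewrite -cards_eq0 cS.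
by have [eS|_ //] := eqVneq S set0; rewrite eS cards0 in cS.
Qed.

Lemma form_int_form k m w : is_form k.+1 m w ->
  is_form k m.+1 (form_int k.+1 m w).
Proof.
move=> hw; change (form_int k.+1 m w \in (is_form k m.+1 : pred form)).
apply: rpredZ.
exact: contr_form euler_linear hw.
Qed.

Lemma lieD_const k X w : vf_linear X -> is_form k.+1 0 w ->
  is_form k.+1 0 (lieD X w).
Proof.
move=> hX hw; rewrite /lieD (extd_const hw).
have -> : contr X 0 = 0.
  apply/ffunP => S; rewrite !ffunE; apply: big1 => j _.
  by rewrite !ffunE mulr0 if_same mulr0.
by rewrite add0r; apply: extd_form; apply: contr_form.
Qed.

Lemma vf_app_homog m X p : vf_linear X -> p \is m.+1.-homog ->
  vf_app X p \is m.+1.-homog.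
Proof.
move=> /forallP hX hp; apply: rpred_sum => j _; rewrite -add1n.
by apply: dhomogM => //; apply: mderiv_homog.
Qed.

Lemma vf_bracket_linear X Y : vf_linear X -> vf_linear Y ->
  vf_linear (vf_bracket X Y).
Proof.
move=> hX hY; apply/forallP => j; rewrite ffunE.
by apply: rpredB; apply: vf_app_homog => //; [move/forallP: hY|move/forallP: hX].
Qed.

Lemma vf_div_bracket X Y : vf_div X = 0 -> vf_div Y = 0 ->
  vf_div (vf_bracket X Y) = 0.
Proof.
move=> dX dY.
have app_div Z (W : vfield) : \sum_j (vf_app Z (W j))^`M(j) =
   \sum_j \sum_i (Z i)^`M(j) * (W j)^`M(i) + vf_app Z (vf_div W).
  rewrite /vf_app /vf_div.
  under [X in _ + X]eq_bigr do rewrite linear_sum mulr_sumr.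
  rewrite [X in _ + X]exchange_big -big_split; apply: eq_bigr => j _ /=.
  rewrite linear_sum -big_split; apply: eq_bigr => i _ /=.
  by rewrite mderivM [(W j)^`M(i)^`M(j)]mderiv_comm.
rewrite {1}/vf_div; under eq_bigr do rewrite ffunE linearB.
rewrite sumrB !app_div dX dY.
have app0 Z : vf_app Z 0 = 0 by apply: big1 => i _; rewrite linear0 mulr0.
rewrite !app0 !addr0 [X in X - _]exchange_big /=.
apply/eqP; rewrite subr_eq0; apply/eqP.
by apply: eq_bigr => j _; apply: eq_bigr => i _; rewrite mulrC.
Qed.

Lemma extdB u v : extd (u - v) = extd u - extd v.
Proof.
rewrite /extd -sumrB; apply: eq_bigr => j _; rewrite -wedgeNr -wedgeDr.
by congr wedge; apply/ffunP => S; rewrite !ffunE linearB.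
Qed.

Lemma extd_wedge_const k u v : is_form k 0 v ->
  extd (wedge u v) = wedge (extd u) v.
Proof.
move=> hv; rewrite /extd wedge_suml; apply: eq_bigr => j _; rewrite -wedgeA.
congr wedge; apply/ffunP => S; rewrite !ffunE linear_sum /=; apply: eq_bigr => T _.
rewrite -signr_odd !mulr_sign; case: (odd _); rewrite ?linearN /= mderivM ffunE;
by rewrite (mderiv_homog0 _ (is_form_homog _ hv)) mulr0 addr0.
Qed.

Lemma extd_extd0 p : extd (extd (form0 p)) = 0.
Proof.
pose D i j := wedge (mon poly [set i]) (wedge (mon poly [set j]) (form0 p^`M(j)^`M(i))).
have -> : extd (extd (form0 p)) = \sum_i \sum_j D i j.
  rewrite /extd; apply: eq_bigr => i _; rewrite -wedge_sumr; congr wedge.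
  apply/ffunP => S; rewrite ffunE !sum_ffunE linear_sum; apply: eq_bigr => j _ /=.
  rewrite !wedge_mon1; case: ifP => _; last by rewrite linear0.
  rewrite -signr_odd !mulr_sign !ffunE.
  by case: (odd _); case: eqP => _; rewrite ?linearN /= ?linear0.
have DC i j : D i j = - D j i.
  rewrite /D !wedgeA mderiv_comm -wedgeNl; congr wedge.
  rewrite (wedgeC (is_form_deg (mon1_form i)) (is_form_deg (mon1_form j))).
  by apply/ffunP => S; rewrite !ffunE mulN1r.
set x := \sum_i _; have xN : x = - x.
  rewrite {1}/x exchange_big /= -sumrN; apply: eq_bigr => i _.
  by rewrite -sumrN; apply: eq_bigr => j _; rewrite DC.
have : 2%:R *: x = 0 by rewrite scaler_nat mulr2n {2}xN subrr.
by move/eqP; rewrite scaler_eq0 pnatr_eq0 /= => /eqP.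
Qed.

Lemma dpart_deg k j w : ext_deg k.+1 w -> ext_deg k (dpart j w).
Proof.
move=> hw S cS; rewrite ffunE; case: ifPn => // jS.
by rewrite hw ?mulr0 // cardsU1 jS add1n eqSS.
Qed.

Lemma dpart_setD1 j w S : j \in S ->
  dpart j w (S :\ j) = (-1) ^+ #|[set k in S | (k < j)%N]| * w S.
Proof.
move=> jS; rewrite ffunE !inE eqxx /= setD1K //; congr (_ ^+ _ * _).
apply: eq_card => k; rewrite !inE; case: eqP => //= ->.
by rewrite ltnn andbF.
Qed.

Lemma extd_int_const k w : is_form k.+1 0 w ->
  extd (form_int k.+1 0 w) = w.
Proof.
move=> hw; apply/ffunP => S; rewrite /extd sum_ffunE.
pose G j : poly := if j \in S then k.+1%:R^-1 *: w S else 0.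
rewrite (eq_bigr G) => [|j _].
  rewrite /G -big_mkcond /= sumr_const.
  have [cS|/(is_form_deg hw)->] := eqVneq #|S| k.+1; last first.
    by rewrite scaler0 mul0rn.
  by rewrite cS -scaler_nat scalerA divff ?scale1r ?pnatr_eq0.
rewrite wedge_mon1 /G; case: ifP => // jS.
rewrite ffunE [form_int _ _ _ _]ffunE linearZ addn0 -scalerAr ffunE; congr (_ *: _).
rewrite linear_sum /= (bigD1 j) //= big1 ?addr0 => [|i /negPf nij].
  rewrite ffunE mderivM mderivX mnm1E eqxx scale1r.
  rewrite [X in _ + _ * X]mderiv_homog0 ?(dpart_homog _ _ hw) // mulr0 addr0.
  by rewrite -{1}[U_(j)%MM]add0m addmK mpolyX0 mul1r dpart_setD1 // mulrA -expr2 sqrr_sign mul1r.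
rewrite ffunE mderivM mderivX mnm1E nij scale0r mul0r add0r.
by rewrite mderiv_homog0 ?mulr0 // (dpart_homog _ _ hw).
Qed.

Lemma card_below (j : 'I_n) : #|[set k in [set: 'I_n] | (k < j)%N]| = j.
Proof.
have winj : injective (widen_ord (ltnW (ltn_ord j))).
  by move=> a b /(congr1 val) /= /val_inj.
rewrite -[RHS](card_ord j) -(card_imset _ winj).
apply: eq_card => k; rewrite !inE; apply/idP/imsetP => [kj|[i _ ->] /=].
  by exists (Ordinal kj) => //; apply: val_inj.
exact: ltn_ord.
Qed.

Lemma card_belowC (j : 'I_n) : #|[set k in [set~ j] | (k < j)%N]| = j.
Proof.
rewrite -[RHS]card_below; apply: eq_card => k; rewrite !inE.
by case: eqP => //= ->; rewrite ltnn.
Qed.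

Lemma vf_of_formK m w : (0 < n)%N -> is_form n.-1 m w ->
  contr (vf_of_form w) (mon _ setT) = w.
Proof.
move=> n0 hw; apply/ffunP => S; rewrite ffunE.
have nz j : j \notin S -> j |: S == setT -> S = [set~ j].
  move=> jS /eqP/setP h; apply/setP => i; have:= h i; rewrite !inE.
  by case: eqP => [->|_] //=; rewrite (negPf jS).
have [cS|cS] := eqVneq #|S| n.-1; last first.
  rewrite (is_form_deg hw cS) big1 // => j _; rewrite [dpart _ _ _]ffunE.
  case: ifPn => [_|jS]; first by rewrite mulr0.
  rewrite [mon _ _ _]ffunE; case: eqP => [/eqP/(nz _ jS) eS|]; last by rewrite !mulr0.
  by rewrite eS cardsC1 card_ord eqxx in cS.
have /set0Pn[j jS] : ~: S != set0.
  by rewrite -card_gt0 cardsCs setCK cS card_ord subn_gt0 prednK.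
rewrite inE in jS.
have eS : S = [set~ j].
  apply/eqP; rewrite eqEcard cardsC1 card_ord cS leqnn andbT.
  by apply/subsetP => i iS; rewrite !inE; apply: contraNneq jS => <-.
rewrite (bigD1 j) //= big1 ?addr0 => [|i nij]; last first.
  by rewrite [dpart _ _ _]ffunE eS !inE nij mulr0.
rewrite !ffunE (negPf jS) eS card_belowC.
have -> : j |: [set~ j] = setT by apply/setP => i; rewrite !inE orbN.
by rewrite eqxx mulr1 mulrAC -expr2 sqrr_sign mul1r.
Qed.

Lemma vf_of_form_linear k w : is_form k 1 w -> vf_linear (vf_of_form w).
Proof.
move=> hw; apply/forallP => j; rewrite ffunE -signr_odd mulr_sign.
by case: ifP => _; rewrite ?rpredN; exact: is_form_homog hw.
Qed.

Lemma vf_of_form_div w : vf_div (vf_of_form w) = extd w setT.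
Proof.
rewrite /extd sum_ffunE; apply: eq_bigr => j _; rewrite wedge_mon1 inE.
rewrite card_below !ffunE -signr_odd !mulr_sign setTD.
by case: (odd _); rewrite ?linearN.
Qed.

End PolynomialForms.

Section PowerSeries.
Variable K : numFieldType.

(* V[[t]] is nat -> V, with its pointwise module structure. A bilinear b extends
   to series by (u t^i, v t^j) |-> b(u, v) t^(i+j). *)
Definition cauchy (U V : Type) (W : nmodType) (b : U -> V -> W)
    (f : nat -> U) (g : nat -> V) : nat -> W :=
  fun n => \sum_(i < n.+1) b (f i) (g (n - i)%N).

Definition tder (V : lmodType K) (f : nat -> V) : nat -> V :=
  fun n => n.+1%:R *: f n.+1.

Definition tint (V : lmodType K) (f : nat -> V) : nat -> V :=
  fun n => if n is m.+1 then n%:R^-1 *: f m else 0.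

Definition tder_pow (V : lmodType K) (k : int) (f : nat -> V) : nat -> V :=
  match k with
  | Posz m => iter m (@tder V) f
  | Negz m => iter m.+1 (@tint V) f
  end.

Definition tmon (V : lmodType K) (n : nat) (v : V) : nat -> V :=
  fun m => if m == n then v else 0.

End PowerSeries.

(* The variables x_2, ..., x_5 have indices 0, ..., 3. *)
Section E16.
Variable K : numFieldType.
Local Notation poly := {mpoly K[4]}.
Local Notation vfield := {ffun 'I_4 -> poly}.
Local Notation form := {ffun {set 'I_4} -> poly}.

Definition is_sl4 (X : vfield) : bool := vf_linear X && (vf_div X == 0).

Lemma is_sl4_submod : submod_closed (is_sl4 : pred vfield).
Proof.
split=> [|a X Y /andP[/forallP lX /eqP dX] /andP[/forallP lY /eqP dY]].
  apply/andP; split; first by apply/forallP => j; rewrite ffunE rpred0.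
  by rewrite /vf_div big1 // => j _; rewrite ffunE linear0.
apply/andP; split.
  by apply/forallP => j; rewrite !ffunE rpredD ?rpredZ.
rewrite /vf_div; under eq_bigr do rewrite !ffunE linearP.
by rewrite big_split -scaler_sumr; move: dX dY; rewrite /vf_div /= => -> ->; rewrite scaler0 addr0.
Qed.

HB.instance Definition _ :=
  GRing.isSubmodClosed.Build K vfield (is_sl4 : pred vfield) is_sl4_submod.

Record sl4 := Sl4 { sl4_vf :> vfield; sl4_vfP : is_sl4 sl4_vf }.
HB.instance Definition _ := [isSub for sl4_vf].
HB.instance Definition _ := [Choice of sl4 by <:].
HB.instance Definition _ := [SubChoice_isSubLmodule of sl4 by <:].

Local Notation S2 := (dhomog 4 K 2).

Record L2 := MkL2 { L2_form :> form; L2_formP : is_form 2 0 L2_form }.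
HB.instance Definition _ := [isSub for L2_form].
HB.instance Definition _ := [Choice of L2 by <:].
HB.instance Definition _ := [SubChoice_isSubLmodule of L2 by <:].

Lemma sl4_linear (X : sl4) : vf_linear X.
Proof. by case/andP: (sl4_vfP X). Qed.

Lemma sl4_div (X : sl4) : vf_div X = 0.
Proof. by case/andP: (sl4_vfP X) => _ /eqP. Qed.

Lemma sl4_of_form_subproof (w : form) :
  is_form 3 1 w -> extd w = 0 -> is_sl4 (vf_of_form w).
Proof.
move=> hw dw; apply/andP; split; first exact: vf_of_form_linear hw.
by rewrite vf_of_form_div dw ffunE.
Qed.

Definition sl4_of_form (w : form) (hw : is_form 3 1 w) (dw : extd w = 0) : sl4 :=
  Sl4 (sl4_of_form_subproof hw dw).

Lemma sl4_bracket_subproof (X Y : sl4) : is_sl4 (vf_bracket X Y).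
Proof.
apply/andP; split; first by apply: vf_bracket_linear; exact: sl4_linear.
by rewrite vf_div_bracket //; exact: sl4_div.
Qed.

Definition sl4_bracket (X Y : sl4) : sl4 := Sl4 (sl4_bracket_subproof X Y).

Lemma sl4_S2_subproof (X : sl4) (p : S2) : vf_app X p \is 2.-homog.
Proof. by apply: vf_app_homog; [exact: sl4_linear | exact: dhomog_is_dhomog]. Qed.

Definition sl4_S2 (X : sl4) (p : S2) : S2 := DHomog (sl4_S2_subproof X p).

Lemma sl4_lie_subproof (X : sl4) (w : L2) : is_form 2 0 (lieD X w).
Proof. by apply: lieD_const; [exact: sl4_linear | exact: L2_formP]. Qed.

Definition sl4_lie (X : sl4) (w : L2) : L2 := MkL2 (sl4_lie_subproof X w).

Lemma sl4_int_subproof (X : sl4) (w : L2) :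
  form_int 1 1 (contr X w) set0 \is 2.-homog.
Proof.
apply: (@is_form_homog _ _ 0); apply: form_int_form; apply: contr_form.
  exact: sl4_linear.
exact: L2_formP.
Qed.

Definition sl4_int (X : sl4) (w : L2) : S2 := DHomog (sl4_int_subproof X w).

Lemma S2_L2_form (p : S2) (w : L2) :
  is_form 3 1 (wedge (extd (form0 p)) w).
Proof.
apply: (@wedge_form _ _ 1 1 2 0); last exact: L2_formP.
by apply: extd_form; apply: form0_form; exact: dhomog_is_dhomog.
Qed.

Lemma S2_L2_closed (p : S2) (w : L2) :
  extd (wedge (extd (form0 p)) w) = 0.
Proof. by rewrite (extd_wedge_const _ (L2_formP w)) extd_extd0 wedge0l. Qed.

Definition S2_L2 (p : S2) (w : L2) : sl4 :=
  sl4_of_form (S2_L2_form p w) (S2_L2_closed p w).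

(* The coefficient of dx_2 dx_3 dx_4 dx_5. *)
Definition L2_wedge (s w : L2) : K^o := (wedge s w setT)@_0%MM.

Lemma L2_int_form (s w : L2) :
  is_form 3 1 (wedge (form_int 2 0 s) w - wedge s (form_int 2 0 w)).
Proof.
have i1 (x : L2) : is_form 1 1 (form_int 2 0 x).
  by apply: form_int_form; exact: L2_formP.
change (wedge (form_int 2 0 s) w - wedge s (form_int 2 0 w)
  \in (is_form 3 1 : pred form)).
apply: rpredB.
  by apply: (@wedge_form _ _ 1 1 2 0); [exact: i1 | exact: L2_formP].
by apply: (@wedge_form _ _ 2 0 1 1); [exact: L2_formP | exact: i1].
Qed.

Lemma wedge_deg2C k (u v : form) : ext_deg 2 u -> ext_deg k v ->
  wedge u v = wedge v u.
Proof.
move=> hu hv; rewrite (wedgeC hu hv); apply/ffunP => S; rewrite ffunE.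
by rewrite exprM sqrrN expr1n expr1n mul1r.
Qed.

Lemma L2_int_closed (s w : L2) :
  extd (wedge (form_int 2 0 s) w - wedge s (form_int 2 0 w)) = 0.
Proof.
have i1 : is_form 1 1 (form_int 2 0 w) by apply: form_int_form; exact: L2_formP.
rewrite (wedge_deg2C (is_form_deg (L2_formP s)) (is_form_deg i1)).
rewrite extdB (extd_wedge_const _ (L2_formP w)) (extd_wedge_const _ (L2_formP s)).
rewrite (extd_int_const (L2_formP s)) (extd_int_const (L2_formP w)).
by rewrite (wedge_deg2C (is_form_deg (L2_formP s)) (is_form_deg (L2_formP w))) subrr.
Qed.

Definition L2_int (s w : L2) : sl4 :=
  sl4_of_form (L2_int_form s w) (L2_int_closed s w).

(* ((W_1, sl_4[[t]]), (S^2[[t]] dt, Lambda^2[[t]] dt)): even part, odd part. *)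
Definition E16 : Type :=
  (((nat -> K^o) * (nat -> sl4)) * ((nat -> S2) * (nat -> L2)))%type.
HB.instance Definition _ := GRing.Lmodule.on E16.

Definition e16_even (x : E16) : Prop := x.2 = 0.
Definition e16_odd (x : E16) : Prop := x.1 = 0.

Definition scal (V : lmodType K) (a : K^o) (v : V) : V := a *: v.

(* v |-> (f v)' - c f' v *)
Definition W1_density (V : lmodType K) (c : K) (f : nat -> K^o) (v : nat -> V)
    : nat -> V :=
  tder (cauchy (@scal V) f v) - c *: cauchy (@scal V) (tder f) v.

(* Brackets of components in the opposite order are given by super-antisymmetry:
   symmetric for two odd elements, antisymmetric otherwise. *)
Definition e16_bracket (x y : E16) : E16 :=
  let: ((f, X), (p, s)) := x in
  let: ((g, Y), (q, w)) := y in
  ((cauchy (@scal _) f (tder g) - cauchy (@scal _) (tder f) g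
      + cauchy L2_wedge s w,
    cauchy sl4_bracket X Y
      + (cauchy (@scal _) f (tder Y) - cauchy (@scal _) g (tder X))
      - (cauchy S2_L2 p w + cauchy S2_L2 q s)
      + 2%:R^-1 *: (cauchy L2_int s (tder w) - cauchy L2_int (tder s) w)),
   (W1_density (1 / 2) f q - W1_density (1 / 2) g p
      + (cauchy sl4_S2 X q - cauchy sl4_S2 Y p)
      + (cauchy sl4_int (tder X) w - cauchy sl4_int (tder Y) s),
    W1_density (3 / 2) f w - W1_density (3 / 2) g s
      + (cauchy sl4_lie X w - cauchy sl4_lie Y s))).

End E16.

Section K16.
Variable K : numFieldType.
Local Notation Lambda := {ffun {set 'I_6} -> K^o}.

Definition K16 : Type := nat -> Lambda.
HB.instance Definition _ := GRing.Lmodule.on K16.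

(* xi_1, xi_2, xi_3, eta_1, eta_2, eta_3 are the generators 0, ..., 5. *)
Definition xi (i : 'I_3) : 'I_6 := lshift 3 i.
Definition eta (i : 'I_3) : 'I_6 := rshift 3 i.

Definition k16_even (f : K16) : Prop :=
  forall n (S : {set 'I_6}), odd #|S| -> f n S = 0.
Definition k16_odd (f : K16) : Prop :=
  forall n (S : {set 'I_6}), ~~ odd #|S| -> f n S = 0.

(* f |-> (-1)^p(f) f *)
Definition k16_par (f : K16) : K16 :=
  fun n => [ffun S : {set 'I_6} => (-1) ^+ #|S| * f n S].

Definition k16_pder (j : 'I_6) (f : K16) : K16 := fun n => dpart j (f n).

Definition k16_euler (f : K16) : K16 := fun n =>
  \sum_(i < 3) (wedge (mon K^o [set xi i]) (dpart (xi i) (f n)) +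
                wedge (mon K^o [set eta i]) (dpart (eta i) (f n))).

Definition k16_bracket (f g : K16) : K16 :=
  cauchy (@wedge K^o 6) (2%:R *: f - k16_euler f) (tder g)
  - cauchy (@wedge K^o 6) (tder f) (2%:R *: g - k16_euler g)
  + \sum_(i < 3)
     (cauchy (@wedge K^o 6) (k16_pder (xi i) (k16_par f)) (k16_pder (eta i) g) +
      cauchy (@wedge K^o 6) (k16_pder (eta i) (k16_par f)) (k16_pder (xi i) g)).

Definition bar (j : 'I_6) : 'I_6 :=
  match split (j : 'I_(3 + 3)) with inl i => eta i | inr i => xi i end.

(* xi_2 xi_3 xi_4 eta_2 eta_3 eta_4 with xi_4 = eta_1 and eta_4 = xi_1. *)
Definition lvol : Lambda :=
  wedge_seq K^o [:: xi 1; xi 2; eta 0; eta 1; eta 2; xi 0].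

(* The scalar is a product of two signs, see sharpP. *)
Definition sharp (I : seq 'I_6) : Lambda :=
  let v := wedge_seq K^o (map bar I) in
  let m := mon K^o (~: [set j in map bar I]) in
  (wedge v m setT * lvol setT) *: m.

Definition sgnA (k : nat) : K := (-1) ^+ (k * k.+1)./2.

(* Coefficientwise in t, hence the continuous extension. The ordering enum S is
   immaterial: k16_A_mon gives the formula for every sequence I without
   repetition. *)
Definition k16_A (f : K16) : K16 := fun n =>
  \sum_(S : {set 'I_6})
    (sgnA #|S| * tder_pow (3%:Z - #|S|%:Z) (fun m => f m S) n)
      *: sharp (enum S).

Definition k16_iota (f : K16) : K16 := f + k16_A f.

Definition k16_iota_image (g : K16) : Prop := exists f, g = k16_iota f.

Lemma wedge_monmon (S T : {set 'I_6}) : [disjoint S & T] ->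
  wedge (mon K^o S) (mon K^o T) = (-1) ^+ ninv S T *: mon K^o (S :|: T).
Proof.
move=> dST; apply/ffunP => V; rewrite !ffunE.
rewrite (bigID (pred1 S)) /= [X in _ + X]big1 ?addr0; last first.
  by move=> W /andP[_ /negPf nW]; rewrite ffunE nW mul0r mulr0.
rewrite (eq_bigl (fun W => (W == S) && (S \subset V))); last first.
  by move=> W; rewrite andbC; case: eqP => // ->.
have [SV|SV] := boolP (S \subset V); last first.
  rewrite big_pred0 => [|W]; last by rewrite andbF.
  case: eqP => [eV|_]; last by rewrite scaler0.
  by rewrite eV finset.subsetUl in SV.
under eq_bigl do rewrite andbT.
rewrite big_pred1_eq !ffunE eqxx mul1r.
have -> : (V :\: S == T) = (V == S :|: T).
  apply/eqP/eqP => [<-|->].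
    by apply/setP => x; rewrite !inE; case xS: (x \in S) => //=; rewrite (subsetP SV).
  by apply/setP => x; rewrite !inE; case xS: (x \in S) => //=; rewrite (disjointFr dST).
case: eqP => [->|_]; last by rewrite scaler0 mulr0.
congr (_ ^+ _ * _); congr ninv; apply/setP => x; rewrite !inE.
by case xS: (x \in S) => //=; rewrite (disjointFr dST).
Qed.

Lemma wedgeZr (a : K) (u v : Lambda) : wedge u (a *: v) = a *: wedge u v.
Proof.
apply/ffunP => S; rewrite !ffunE scaler_sumr; apply: eq_bigr => T _.
by rewrite ffunE /GRing.scale /=; ring.
Qed.

Lemma wedgeZl (a : K) (u v : Lambda) : wedge (a *: u) v = a *: wedge u v.
Proof.
apply/ffunP => S; rewrite !ffunE scaler_sumr; apply: eq_bigr => T _.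
by rewrite ffunE /GRing.scale /=; ring.
Qed.

Lemma mon_deg (S : {set 'I_6}) : ext_deg #|S| (mon K^o S).
Proof.
by move=> T cT; rewrite ffunE; have [eT|//] := eqVneq T S; rewrite eT eqxx in cT.
Qed.

Lemma gen_anticomm (i j : 'I_6) (u : Lambda) :
  wedge (mon K^o [set i]) (wedge (mon K^o [set j]) u) =
  - wedge (mon K^o [set j]) (wedge (mon K^o [set i]) u).
Proof.
rewrite !wedgeA -wedgeNl; congr wedge.
rewrite (wedgeC (@mon_deg _) (@mon_deg _)) !cards1.
by apply/ffunP => S; rewrite ffunE [RHS]ffunE mulN1r.
Qed.

Lemma wedge_seq_swap (x : 'I_6) (s1 s2 : seq 'I_6) :
  wedge_seq K^o (s1 ++ x :: s2) =
  (-1) ^+ size s1 *: wedge_seq K^o (x :: s1 ++ s2).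
Proof.
elim: s1 => [|y s1 IH]; first by rewrite scale1r.
by rewrite /= IH wedgeZr gen_anticomm scalerN -scaleNr exprS mulN1r.
Qed.

Lemma perm_wedge_seq (s s' : seq 'I_6) : perm_eq s s' ->
  exists b : bool, forall h : 'I_6 -> 'I_6,
    wedge_seq K^o (map h s) = (-1) ^+ b *: wedge_seq K^o (map h s').
Proof.
elim: s s' => [|x s IH] s'.
  by rewrite perm_sym => /perm_nilP ->; exists false => h; rewrite scale1r.
move=> pe; have xs' : x \in s' by rewrite -(perm_mem pe) mem_head.
have [s1 [s2 es']] : exists s1 s2, s' = s1 ++ x :: s2.
  by case/splitPr: xs' => s1 s2; exists s1, s2.
move: pe; rewrite es' perm_sym -cat1s perm_catCA /= perm_cons perm_sym => /IH[b hb].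
exists (b (+) odd (size s1)) => h.
rewrite map_cat /= wedge_seq_swap scalerA size_map signr_addb signr_odd.
by rewrite -mulrA -exprD addnn -mul2n exprM sqrrN !expr1n mulr1 hb map_cat wedgeZr.
Qed.

Lemma wedge_mon0 (u : Lambda) : wedge (mon K^o set0) u = u.
Proof.
apply/ffunP => S; rewrite ffunE (bigD1 set0) ?sub0set //= big1 ?addr0.
  by rewrite ffunE eqxx setD0 mul1r /ninv big_set0 mul1r.
by move=> T /andP[_ /negPf nT]; rewrite ffunE nT mul0r mulr0.
Qed.

Lemma wedge_seq_sorted (s : seq 'I_6) : sorted (relpre val ltn) s ->
  wedge_seq K^o s = mon K^o [set j in s].
Proof.
elim: s => [|x s IH] /=; first by move=> _; congr mon; apply/setP => j; rewrite !inE.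
move=> ps; rewrite IH ?(path_sorted ps) //.
have xlt j : j \in s -> (x < j)%N.
  move: ps; rewrite path_sortedE => [/andP[/allP h _]|]; first by move/h.
  by move=> a b c; apply: ltn_trans.
rewrite wedge_monmon; last first.
  rewrite disjoints1 inE; apply/negP => /xlt; by rewrite ltnn.
have -> : ninv [set x] [set j in s] = 0%N.
  rewrite /ninv big_set1; apply/eqP; rewrite cards_eq0; apply/eqP/setP => j.
  rewrite !inE; apply/negP => /andP[/xlt xj jx].
  by have := ltn_trans xj jx; rewrite ltnn.
by rewrite scale1r; congr mon; apply/setP => j; rewrite !inE.
Qed.

Lemma wedge_seq_enum (S : {set 'I_6}) : wedge_seq K^o (enum S) = mon K^o S.
Proof.
rewrite wedge_seq_sorted; first by congr mon; apply/setP => j; rewrite inE mem_enum.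
rewrite {1}/enum_mem; apply: sorted_filter => [a b c|]; first exact: ltn_trans.
by rewrite -sorted_map -enumT val_enum_ord iota_ltn_sorted.
Qed.

Lemma wedge_seq_uniq (s : seq 'I_6) : uniq s ->
  exists b : bool, wedge_seq K^o s = (-1) ^+ b *: mon K^o [set j in s].
Proof.
move=> us; have [|b /(_ id)] := @perm_wedge_seq s (enum [set j in s]).
  by apply: uniq_perm; rewrite ?enum_uniq // => j; rewrite mem_enum inE.
by rewrite !map_id wedge_seq_enum => e; exists b.
Qed.

Lemma barK : involutive bar.
Proof.
move=> j; rewrite /bar; case: (splitP (j : 'I_(3 + 3))) => k ek.
  case: splitP => l /= el; first by have := ltn_ord l; rewrite -el ltnNge leq_addr.
  by apply: val_inj; rewrite /= ek; move/eqP: el; rewrite eqn_add2l => /eqP.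
case: splitP => l /= el.
  by apply: val_inj; rewrite /= ek el.
by have := ltn_ord k; rewrite el ltnNge leq_addr.
Qed.

Lemma lvolE : exists b : bool, lvol = (-1) ^+ b *: mon K^o setT.
Proof.
have [|b e] := @wedge_seq_uniq [:: xi 1; xi 2; eta 0; eta 1; eta 2; xi 0].
  by [].
exists b; rewrite /lvol e; congr (_ *: mon _ _); apply/setP => j.
by rewrite !inE -!val_eqE /=; case: j; do 6!case=> //.
Qed.

Lemma sharpP (I : seq 'I_6) : uniq I ->
  wedge (wedge_seq K^o (map bar I)) (sharp I) = lvol.
Proof.
move=> uI; rewrite /sharp wedgeZr.
have [|b ->] := @wedge_seq_uniq (map bar I).
  by rewrite (map_inj_uniq (inv_inj barK)) uI.
have [d ->] := lvolE.
set B := [set j in _].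
have dB : [disjoint B & ~: B] by rewrite -setI_eq0 setICr.
rewrite wedgeZl (wedge_monmon dB) setUCr !ffunE eqxx scalerA scalerA.
congr (_ *: _); rewrite /GRing.scale /= !mulr1.
set x := (-1) ^+ b; set y := (-1) ^+ ninv _ _; set z := (-1) ^+ d.
have -> : x * y * z * x * y = x ^+ 2 * y ^+ 2 * z by ring.
by rewrite !sqrr_sign !mul1r.
Qed.

Lemma tder_powZ (k : int) (a : K) (f : nat -> K^o) :
  tder_pow k (a *: f) = a *: tder_pow k f.
Proof.
have dZ (g : nat -> K^o) : tder (a *: g) = a *: tder g.
  by apply/funext => n; rewrite /tder /= !fctE !scalerA mulrC.
have iZ (g : nat -> K^o) : tint (a *: g) = a *: tint g.
  apply/funext => -[|n]; rewrite /tint /= !fctE ?scaler0 //.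
  by rewrite !scalerA mulrC.
by case: k => m; rewrite /tder_pow; [|move: m.+1 => {}m];
  elim: m => [|m IH] //=; rewrite IH ?dZ ?iZ.
Qed.

Lemma k16_A_mon (I : seq 'I_6) (n : nat) : uniq I ->
  k16_A (tmon n (wedge_seq K^o I)) =
  fun m => (sgnA (size I) * tder_pow (3%:Z - (size I)%:Z) (tmon n (1 : K^o)) m)
    *: sharp I.
Proof.
move=> uI; apply/funext => m; rewrite /k16_A.
pose S := [set j in I].
have pS : perm_eq I (enum S).
  by apply: uniq_perm; rewrite ?enum_uniq // => j; rewrite mem_enum inE.
have [b hb] := perm_wedge_seq pS.
have eI : wedge_seq K^o I = (-1) ^+ b *: mon K^o S.
  by have := hb id; rewrite !map_id wedge_seq_enum.
have fE (T : {set 'I_6}) : (fun k => tmon n (wedge_seq K^o I) k T) =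
    ((-1) ^+ b * (T == S)%:R : K) *: tmon n (1 : K^o).
  apply/funext => k; rewrite eI /tmon fctE; case: eqP => _; rewrite !ffunE ?scaler0 //.
  by rewrite /GRing.scale /= mulr1.
rewrite (bigD1 S) //= big1 ?addr0; last first.
  move=> T /negPf nT; rewrite fE nT mulr0 tder_powZ scale0r.
  by rewrite -[X in _ * X]/(0 : K) mulr0 scale0r.
have cS : #|S| = size I by rewrite (perm_size pS) cardE.
have eSI : sharp I = (-1) ^+ b *: sharp (enum S).
  rewrite /sharp hb.
  have -> : [set j in map bar I] = [set j in map bar (enum S)].
    by apply/setP => j; rewrite !inE; apply: perm_mem; apply: perm_map.
  by rewrite wedgeZl ffunE scalerA mulrA.
rewrite fE eqxx mulr1 tder_powZ eSI cS; move: (sharp (enum S)) => v.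
rewrite [RHS]scalerA; congr (_ *: _).
by rewrite -[(_ *: _) m]/((-1) ^+ b * _) mulrCA mulrC.
Qed.

End K16.

Section Superalgebras.
Variable K : numFieldType.

(* P is a graded subspace closed under br. *)
Definition is_subsuperalgebra (V : lmodType K) (even odd : V -> Prop)
    (br : V -> V -> V) (P : V -> Prop) : Prop :=
  [/\ P 0,
      forall (a : K) x y, P x -> P y -> P (a *: x + y),
      forall x, P x ->
        exists x0 x1, [/\ P x0, even x0, P x1, odd x1 & x = x0 + x1]
    & forall x y, P x -> P y -> P (br x y)].

Definition isomorphic_to_sub (U V : lmodType K)
    (evenU oddU : U -> Prop) (brU : U -> U -> U)
    (evenV oddV : V -> Prop) (brV : V -> V -> V) (P : V -> Prop) : Prop :=
  exists phi : {linear U -> V},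
    [/\ injective phi,
        forall v, P v <-> exists u, v = phi u,
        forall u, evenU u -> evenV (phi u),
        forall u, oddU u -> oddV (phi u)
      & forall x y, phi (brU x y) = brV (phi x) (phi y)].
End Superalgebras.

(* Main.v *)
Require Import Defs.
From HB Require Import structures.
From mathcomp Require Import boolp functions reals.
From mathcomp Require Import all_boot all_order all_algebra.
From mathcomp Require Import complex mpoly ring.

Set Implicit Arguments.
Unset Strict Implicit.
Unset Printing Implicit Defensive.
Import GRing.Theory Num.Theory.
Local Open Scope ring_scope.

(** An element of the image of iota is determined by its part of degree at most
    3 in the odd variables, the part of degree 3 being self-dual.  Degrees 0, 1,
    2, 3 are matched with W_1, Lambda^2, sl_4 and S^2 respectively: sl_4 acts on
    the six-dimensional quadratic space Lambda^2(C^4) as so_6 = Lambda^2(C^6), and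
    S^2(C^4) is the self-dual half of Lambda^3(C^6).  The resulting map phi from
    E(1,6) to K(1,6) is given in coordinates by linear differential operators with
    constant rational coefficients, and both brackets are bilinear differential
    operators of this kind, so that compatibility of phi with the brackets is an
    identity between finite formal sums of terms c * D^d x_v * D^e y_w with integer
    coefficients, which is decided by computation. *)

(** [A] involves iterated integrals, so it is not a differential operator. The obstacle is avoided
    by describing the image of iota through equations. Since differentiation undoes integration, g =
    f + A(f) satisfies, for every monomial of degree k >= 3, that its coefficient is a sign times
    the (k-3)-th derivative of the coefficient of the dual monomial of degree 6-k. These equations
    contain only derivatives and characterise the image, so phi needs only derivatives as well. They
    are oriented from low to high degree because integrating a derivative loses constants.

    Closure of the image under the bracket is not shown separately: it follows once phi respects
    brackets and has the image of iota as its range.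

    Coordinates are multiplied by 2 or 4 to stay integral, so the field does not enter the
    computation. The coordinates on E(1,6) are linearly dependent (zero trace, symmetry of quadratic
    forms, forms supported in degree 2), hence the two sides are rewritten in independent
    coordinates before they are compared. *)

Local Notation mask := (seq bool).

(** * Formal sums and power series *)

(* A list of type seq (int * k) stands for a formal integral combination of
   elements of k. *)
Section FormalSums.
Implicit Types (k : Type).

Definition fscale k (c : int) (l : seq (int * k)) := [seq (c * m.1, m.2) | m <- l].
Definition fmap k k' (h : k -> k') (l : seq (int * k)) := [seq (m.1, h m.2) | m <- l].
Definition fbind k k' (l : seq (int * k)) (s : k -> seq (int * k')) :=
  flatten [seq fscale m.1 (s m.2) | m <- l].
Definition ftens k k' (l : seq (int * k)) (l' : seq (int * k')) :=
  fbind l (fun a => fmap (pair a) l').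
Definition fcoef (k : eqType) (l : seq (int * k)) (a : k) : int :=
  foldr (fun m c => if m.2 == a then m.1 + c else c) 0 l.
(** Only atoms occurring in one of the lists are tested, since every other atom has coefficient 0 in
    both; this makes the test finite. *)
Definition feq (k : eqType) (l l' : seq (int * k)) :=
  all (fun a => fcoef l a == fcoef l' a) (map snd (l ++ l')).

Variables (K : numFieldType) (V : lmodType K).

Definition feval k (e : k -> V) (l : seq (int * k)) : V :=
  \sum_(m <- l) m.1%:~R *: e m.2.

Lemma feval_nil k (e : k -> V) : feval e [::] = 0.
Proof. exact: big_nil. Qed.

Lemma feval_cons k (e : k -> V) c a l :
  feval e ((c, a) :: l) = c%:~R *: e a + feval e l.
Proof. exact: big_cons. Qed.

Lemma feval_cat k (e : k -> V) l l' : feval e (l ++ l') = feval e l + feval e l'.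
Proof. exact: big_cat. Qed.

Lemma feval_scale k (e : k -> V) c l : feval e (fscale c l) = c%:~R *: feval e l.
Proof.
rewrite /feval big_map scaler_sumr; apply: eq_bigr => m _.
by rewrite intrM scalerA.
Qed.

Lemma feval_map k k' (e : k' -> V) (h : k -> k') l :
  feval e (fmap h l) = feval (e \o h) l.
Proof. by rewrite /feval big_map. Qed.

Lemma feval_flatten k (I : Type) (e : k -> V) (F : I -> seq (int * k)) (r : seq I) :
  feval e (flatten [seq F i | i <- r]) = \sum_(i <- r) feval e (F i).
Proof. by rewrite /feval big_flatten big_map. Qed.

Lemma feval_bind k k' (e : k' -> V) (l : seq (int * k)) (s : k -> seq (int * k')) :
  feval e (fbind l s) = feval (fun a => feval e (s a)) l.
Proof. by rewrite feval_flatten; apply: eq_bigr => m _; rewrite feval_scale. Qed.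

Lemma eq_feval k (e e' : k -> V) l : e =1 e' -> feval e l = feval e' l.
Proof. by move=> h; apply: eq_bigr => m _; rewrite h. Qed.

Lemma eq_feval_seq (k : eqType) (e e' : k -> V) l :
  (forall m, m \in l -> e m.2 = e' m.2) -> feval e l = feval e' l.
Proof. by move=> h; apply: eq_big_seq => m /h ->. Qed.

Lemma feval_linear k (e e' : k -> V) c l :
  feval (fun a => c *: e a + e' a) l = c *: feval e l + feval e' l.
Proof.
rewrite /feval scaler_sumr -big_split; apply: eq_bigr => m _ /=.
by rewrite scalerDr !scalerA mulrC.
Qed.

Lemma feval0 k l : feval (fun _ : k => 0) l = 0.
Proof. by rewrite /feval big1 // => m _; rewrite scaler0. Qed.

Lemma feval_scalel k (e : k -> V) c l : feval (fun a => c *: e a) l = c *: feval e l.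
Proof.
by rewrite -[RHS]addr0 -(feval0 l) -feval_linear; apply: eq_feval => a; rewrite addr0.
Qed.

Lemma fcoefE (k : eqType) (l : seq (int * k)) a :
  fcoef l a = \sum_(m <- l | m.2 == a) m.1.
Proof. by elim: l => [|m l IH]; rewrite ?big_nil //= big_cons IH. Qed.

Lemma feval_coef (k : eqType) (e : k -> V) (s : seq k) (l : seq (int * k)) :
  uniq s -> {subset map snd l <= s} ->
  feval e l = \sum_(a <- s) (fcoef l a)%:~R *: e a.
Proof.
move=> us hs; under eq_bigr do rewrite fcoefE rmorph_sum scaler_suml big_mkcond.
rewrite exchange_big; apply: eq_big_seq => m /= lm.
rewrite (bigD1_seq m.2) ?eqxx //=; last by apply: hs; apply: map_f.
by rewrite big1 ?addr0 // => a /negPf na; rewrite eq_sym na.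
Qed.

(** Both sums are regrouped over one duplicate-free list containing both supports, where the
    integral coefficients agree term by term. *)
Lemma feqP (k : eqType) (e : k -> V) (l l' : seq (int * k)) :
  feq l l' -> feval e l = feval e l'.
Proof.
move=> /allP h; pose s := undup (map snd (l ++ l')).
have sE a : (a \in s) = (a \in map snd l) || (a \in map snd l').
  by rewrite mem_undup map_cat mem_cat.
rewrite !(@feval_coef _ _ s) ?undup_uniq //; first last.
- by move=> a al; rewrite sE al.
- by move=> a al; rewrite sE al orbT.
by apply: eq_big_seq => a; rewrite mem_undup => /h /eqP ->.
Qed.

End FormalSums.

(** * Power series, their products and bilinear differential operators *)

Section Series.
Variable K : numFieldType.
Local Notation ser := (nat -> K^o).
Implicit Types (f g : ser).

Definition smul f g : ser := cauchy (fun a b : K^o => a * b : K^o) f g.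

Lemma smulC f g : smul f g = smul g f.
Proof.
apply/funext => n; rewrite /smul /cauchy (reindex_inj rev_ord_inj) /=.
by apply: eq_bigr => i _; rewrite mulrC subSS subKn // -ltnS.
Qed.

Lemma smulPl c f g h : smul (c *: f + g) h = c *: smul f h + smul g h.
Proof.
apply/funext => n; rewrite /smul /cauchy !fctE scaler_sumr -big_split.
by apply: eq_bigr => i _; rewrite mulrDl -scalerAl.
Qed.

Lemma smul0l f : smul 0 f = 0.
Proof. by have := smulPl (-1) f f f; rewrite scaleN1r addNr scaleN1r addNr. Qed.

Lemma smulZl c f g : smul (c *: f) g = c *: smul f g.
Proof. by rewrite -[c *: f]addr0 smulPl smul0l addr0. Qed.

Lemma smulZr c f g : smul f (c *: g) = c *: smul f g.
Proof. by rewrite !(smulC f) smulZl. Qed.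

Lemma smulDl f g h : smul (f + g) h = smul f h + smul g h.
Proof. by have := smulPl 1 f g h; rewrite !scale1r. Qed.

Lemma smul_suml I (r : seq I) (F : I -> ser) g :
  smul (\sum_(i <- r) F i) g = \sum_(i <- r) smul (F i) g.
Proof. by apply: (big_morph (smul^~ g)) => [u v|]; [exact: smulDl|exact: smul0l]. Qed.

Lemma tderP (V : lmodType K) c (u v : nat -> V) :
  tder (c *: u + v) = c *: tder u + tder v.
Proof.
by apply/funext => n; rewrite /tder !fctE scalerDr !scalerA mulrC.
Qed.

Lemma tder0 (V : lmodType K) : tder (0 : nat -> V) = 0.
Proof. by apply/funext => n; rewrite /tder scaler0. Qed.

Lemma tderZ (V : lmodType K) c (u : nat -> V) : tder (c *: u) = c *: tder u.
Proof. by rewrite -[c *: u]addr0 tderP tder0 addr0. Qed.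

Lemma tder_smul f g : tder (smul f g) = smul (tder f) g + smul f (tder g).
Proof.
apply/funext => n; rewrite fctE /tder /smul /cauchy scaler_sumr.
(* The factor n + 1 is split as i + (n + 1 - i). The first sum loses its term i = 0 and the second
   its term i = n + 1, which gives the two products of the Leibniz rule. *)
rewrite (eq_bigr (fun i : 'I_n.+2 => (i%:R * (f i * g (n.+1 - i)%N) : K^o)
    + (n.+1 - i)%:R * (f i * g (n.+1 - i)%N))); last first.
  by move=> i _; rewrite -mulrDl -natrD subnKC // -ltnS.
rewrite big_split; congr (_ + _).
  rewrite big_ord_recl mul0r [LHS]add0r; apply: eq_bigr => i _.
  by rewrite mulrA.
rewrite big_ord_recr /= subnn mul0r [LHS]addr0; apply: eq_bigr => i _ /=.
by rewrite subSn 1?mulrCA // -ltnS.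
Qed.

Definition sere (k : Type) (x : k -> ser) (a : k * nat) : ser :=
  iter a.2 (@tder K K^o) (x a.1).
Definition bile (k k' : Type) (x : k -> ser) (y : k' -> ser)
  (a : (k * nat) * (k' * nat)) : ser := smul (sere x a.1) (sere y a.2).

Lemma iter_tderP n (V : lmodType K) c (u v : nat -> V) :
  iter n (@tder K V) (c *: u + v) = c *: iter n (@tder K V) u + iter n (@tder K V) v.
Proof. by elim: n => //= n ->; rewrite tderP. Qed.

Lemma feval_tder k (x : k -> ser) l :
  tder (feval x l) = feval (fun a => tder (x a)) l.
Proof.
elim: l => [|[c a] l IH]; first by rewrite !feval_nil tder0.
by rewrite !feval_cons tderP IH.
Qed.

Lemma feval_smull k (x : k -> ser) l g :
  smul (feval x l) g = feval (fun a => smul (x a) g) l.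
Proof.
by rewrite /feval smul_suml; apply: eq_bigr => m _; rewrite smulZl.
Qed.

Lemma feval_smulr k (x : k -> ser) l g :
  smul g (feval x l) = feval (fun a => smul g (x a)) l.
Proof. by rewrite smulC feval_smull; apply: eq_feval => a; rewrite smulC. Qed.

Lemma feval_tens k k' (x : k -> ser) (y : k' -> ser) l l' :
  feval (fun a => smul (x a.1) (y a.2)) (ftens l l') = smul (feval x l) (feval y l').
Proof.
rewrite feval_bind feval_smull; apply: eq_feval => a.
by rewrite feval_map feval_smulr.
Qed.

Lemma bile_tens k k' (x : k -> ser) (y : k' -> ser) l l' :
  feval (bile x y) (ftens l l') = smul (feval (sere x) l) (feval (sere y) l').
Proof. exact: feval_tens. Qed.

Definition lder k (n : nat) (l : seq (int * (k * nat))) :=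
  fmap (fun a => (a.1, n + a.2)%N) l.

Lemma lderE k (x : k -> ser) n l :
  feval (sere x) (lder n l) = iter n (@tder K K^o) (feval (sere x) l).
Proof.
rewrite feval_map; elim: n => [|n IH] /=; first by apply: eq_feval => -[].
by rewrite -IH feval_tder; apply: eq_feval.
Qed.

(** The Leibniz rule on formal sums. It is needed because the coordinates of phi in degree above 3
    contain derivatives, which then fall on brackets. *)
Definition bder k k' (b : seq (int * ((k * nat) * (k' * nat)))) :=
  fbind b (fun a => [:: (1%Z, ((a.1.1, a.1.2.+1), a.2));
                        (1%Z, (a.1, (a.2.1, a.2.2.+1)))]).

Lemma bderE k k' (x : k -> ser) (y : k' -> ser) b :
  feval (bile x y) (bder b) = tder (feval (bile x y) b).
Proof.
rewrite feval_bind feval_tder; apply: eq_feval => a.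
by rewrite !feval_cons feval_nil addr0 !scale1r /bile tder_smul.
Qed.

Lemma iter_bderE k k' (x : k -> ser) (y : k' -> ser) n b :
  feval (bile x y) (iter n (@bder k k') b) = iter n (@tder K K^o) (feval (bile x y) b).
Proof. by elim: n => //= n IH; rewrite bderE IH. Qed.

End Series.

(* A subset of 'I_n is encoded by its characteristic bit sequence of length n. *)
Section Masks.
Variable n : nat.
Implicit Types b c d : seq bool.

Definition set_of_mask b : {set 'I_n} := [set i : 'I_n | nth false b i].
Definition mask_of_set (S : {set 'I_n}) : seq bool := [seq i \in S | i <- enum 'I_n].
Definition masks : seq (seq bool) :=
  iter n (fun l => [seq x :: b | x <- [:: false; true], b <- l]) [:: [::]].
Definition mfull : seq bool := nseq n true.
Definition munit i : seq bool := mkseq (fun j => j == i) n.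
Definition mdiff b c : seq bool := mkseq (fun i => nth false b i && ~~ nth false c i) n.
Definition madd i b : seq bool := mkseq (fun j => (j == i) || nth false b j) n.
Definition msub b c : bool := all (fun i => nth false b i ==> nth false c i) (iota 0 n).
Definition mlt b i : nat := count (fun j => nth false b j && (j < i)%N) (iota 0 n).
Definition minv b c : nat :=
  sumn [seq if nth false b i then mlt c i else 0%N | i <- iota 0 n].
Definition sgnz (k : nat) : int := if odd k then -1 else 1.

Lemma sgnzE (R : pzRingType) k : (sgnz k)%:~R = (-1) ^+ k :> R.
Proof. by rewrite /sgnz -signr_odd; case: odd. Qed.

Lemma mem_masks b : (b \in masks) = (size b == n).
Proof.
rewrite /masks; elim: n b => [|m IH] b; first by case: b.
rewrite iterS; case: b => [|x b].
  by apply/negbTE/negP => /allpairsP[[y c] []].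
rewrite [size _]/= eqSS -IH; apply/allpairsP/idP => [[[y c] [_ hc [_ ->]]] //|hb].
by exists (x, b); split=> //; case: x.
Qed.

Lemma masks_uniq : uniq masks.
Proof.
rewrite /masks; elim: n => // m IH; rewrite iterS.
by apply: allpairs_uniq => //= -[x b] [y c] _ _ [-> ->].
Qed.

Lemma size_mask_of_set S : size (mask_of_set S) = n.
Proof. by rewrite size_map size_enum_ord. Qed.

Lemma nth_mask_of_set S (i : 'I_n) : nth false (mask_of_set S) i = (i \in S).
Proof. by rewrite (nth_map i) ?size_enum_ord // nth_ord_enum. Qed.

Lemma mask_of_setK : cancel mask_of_set set_of_mask.
Proof. by move=> S; apply/setP => i; rewrite inE nth_mask_of_set. Qed.

Lemma set_of_maskK b : size b = n -> mask_of_set (set_of_mask b) = b.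
Proof.
move=> sb; apply: (@eq_from_nth _ false); rewrite size_mask_of_set // => i lti.
by rewrite (nth_mask_of_set _ (Ordinal lti)) inE.
Qed.

Lemma set_of_maskP S : exists2 b, size b = n & S = set_of_mask b.
Proof. by exists (mask_of_set S); rewrite ?size_mask_of_set ?mask_of_setK. Qed.

(** Replaces a sum over subsets by a sum over an explicit list, on which signs and products can be
    evaluated. *)
Lemma sum_masks (R : nmodType) (P : pred {set 'I_n}) (F : {set 'I_n} -> R) :
  \sum_(S | P S) F S = \sum_(b <- masks | P (set_of_mask b)) F (set_of_mask b).
Proof.
rewrite -(big_map set_of_mask P F); apply: perm_big; apply: uniq_perm.
- exact: index_enum_uniq.
- rewrite map_inj_in_uniq ?masks_uniq // => b c; rewrite !mem_masks.
  by move=> /eqP sb /eqP sc e; rewrite -(set_of_maskK sb) e set_of_maskK.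
move=> S; rewrite mem_index_enum; apply/esym/mapP.
exists (mask_of_set S); last by rewrite mask_of_setK.
by rewrite mem_masks size_mask_of_set.
Qed.

Lemma big_ord_iota (R : Type) (idx : R) (op : Monoid.law idx) (F : nat -> R) :
  \big[op/idx]_(i < n) F i = \big[op/idx]_(i <- iota 0 n) F i.
Proof. by rewrite -(big_mkord xpredT) /index_iota subn0. Qed.

Lemma card_ord_iota (P : pred nat) : #|[set i : 'I_n | P i]| = count P (iota 0 n).
Proof.
rewrite -sum1_card -sum1_count big_mkcond [RHS]big_mkcond /= -big_ord_iota.
by apply: eq_bigr => i _; rewrite inE.
Qed.

Lemma card_st b : size b = n -> #|set_of_mask b| = count id b.
Proof.
move=> sb; rewrite card_ord_iota -[in RHS](mkseq_nth false b) count_map sb.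
exact: eq_count.
Qed.

Lemma card_lt_st b (i : nat) : #|[set j in set_of_mask b | (j < i)%N]| = mlt b i.
Proof.
by rewrite /mlt -card_ord_iota; apply: eq_card => j; rewrite !inE.
Qed.

Lemma ninv_st b c : ninv (set_of_mask b) (set_of_mask c) = minv b c.
Proof.
rewrite /minv sumnE big_map -big_ord_iota /ninv [LHS]big_mkcond /=.
by apply: eq_bigr => i _; rewrite inE card_lt_st.
Qed.

Lemma nth_mkseq_ord (F : nat -> bool) (i : 'I_n) : nth false (mkseq F n) i = F i.
Proof. by rewrite nth_mkseq. Qed.

Lemma st_mdiff b c : set_of_mask (mdiff b c) = set_of_mask b :\: set_of_mask c.
Proof. by apply/setP => i; rewrite !inE nth_mkseq_ord andbC. Qed.

Lemma st_madd (i : 'I_n) b : set_of_mask (madd i b) = i |: set_of_mask b.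
Proof. by apply/setP => j; rewrite !inE nth_mkseq_ord. Qed.

Lemma st_munit (i : 'I_n) : set_of_mask (munit i) = [set i].
Proof. by apply/setP => j; rewrite !inE nth_mkseq_ord. Qed.

Lemma st_mfull : set_of_mask mfull = setT.
Proof. by apply/setP => j; rewrite !inE nth_nseq ltn_ord. Qed.

Lemma subset_st b c : (set_of_mask b \subset set_of_mask c) = msub b c.
Proof.
apply/subsetP/allP => [h i|h i].
  rewrite mem_iota add0n /= => lti; apply/implyP => bi.
  by have := h (Ordinal lti); rewrite !inE; apply.
by rewrite !inE; apply/implyP/h; rewrite mem_iota add0n ltn_ord.
Qed.

(** The structure constants of the exterior product at one basis monomial: all ways to split it into
    two factors, with their signs. *)
Definition wedgeF b : seq (int * (seq bool * seq bool)) :=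
  [seq (sgnz (minv c (mdiff b c)), (c, mdiff b c)) | c <- masks & msub c b].

Definition dpartF i b : seq (int * seq bool) :=
  if nth false b i then [::] else [:: (sgnz (mlt b i), madd i b)].

Lemma size_wedgeF b m : m \in wedgeF b -> size m.2.1 = n /\ size m.2.2 = n.
Proof.
case/mapP => c; rewrite mem_filter mem_masks => /andP[_ /eqP sc] -> /=.
by split=> //; exact: size_mkseq.
Qed.

Variable A : comNzRingType.
Local Notation ext := {ffun {set 'I_n} -> A}.
Implicit Types (u v : ext).

Lemma wedge_st u v b : wedge u v (set_of_mask b) =
  \sum_(m <- wedgeF b) m.1%:~R * (u (set_of_mask m.2.1) * v (set_of_mask m.2.2)).
Proof.
rewrite big_map big_filter /= ffunE sum_masks; apply: eq_big => [c|c _].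
  by rewrite subset_st.
by rewrite sgnzE -ninv_st st_mdiff.
Qed.

Lemma dpart_st (i : 'I_n) u b : dpart i u (set_of_mask b) =
  \sum_(m <- dpartF i b) m.1%:~R * u (set_of_mask m.2).
Proof.
rewrite ffunE /dpartF inE; case: ifP => _; first by rewrite big_nil.
by rewrite big_seq1 /= sgnzE card_lt_st st_madd.
Qed.

End Masks.

(** * The bracket of K(1,6) in coordinates *)

(* The term (-1)^p(f) (df/de_i) (dg/de_j) of the bracket. *)
Definition contrF (i j : nat) (b : mask) : seq (int * ((mask * nat) * (mask * nat))) :=
  fbind (wedgeF 6 b) (fun m => fmap (fun k => ((k.1, 0%N), (k.2, 0%N)))
    (ftens (fbind (dpartF 6 i m.1) (fun c => [:: (sgnz (count id c), c)]))
           (dpartF 6 j m.2))).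

(** A monomial of degree d is an eigenvector of 2 - E with eigenvalue 2 - d; the second entry also
    carries the minus sign of the bracket. The indices i and 3 + i are those of a xi and the
    corresponding eta. *)
Definition kbrF (b : mask) : seq (int * ((mask * nat) * (mask * nat))) :=
  fbind (wedgeF 6 b) (fun m =>
    [:: (2 - (count id m.1)%:Z, ((m.1, 0%N), (m.2, 1%N)));
        ((count id m.2)%:Z - 2, ((m.1, 1%N), (m.2, 0%N)))])
  ++ flatten [seq contrF i (3 + i) b ++ contrF (3 + i) i b | i <- iota 0 3].

Section K16Coordinates.
Variable K : numFieldType.
Local Notation Lambda := {ffun {set 'I_6} -> K^o}.
Implicit Types f g : K16 K.

Definition kco f (b : mask) : nat -> K^o := fun n => f n (set_of_mask 6 b).

Lemma kcoD f g b : kco (f + g) b = kco f b + kco g b.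
Proof. by apply/funext => n; rewrite /kco !fctE ffunE. Qed.

Lemma kcoZ c f b : kco (c *: f) b = c *: kco f b.
Proof. by apply/funext => n; rewrite /kco !fctE ffunE. Qed.

Lemma kcoN f b : kco (- f) b = - kco f b.
Proof. by apply/funext => n; rewrite /kco !fctE ffunE. Qed.

Lemma kco_sum (I : Type) (r : seq I) (F : I -> K16 K) b :
  kco (\sum_(i <- r) F i) b = \sum_(i <- r) kco (F i) b.
Proof.
apply: (big_morph (kco^~ b)) => [f g|]; first exact: kcoD.
by apply/funext => n; rewrite /kco -[(0 : K16 K) n]/(0 : Lambda) ffunE.
Qed.

Lemma kco_tder f b : kco (tder f) b = tder (kco f b).
Proof. by apply/funext => n; rewrite /kco /tder ffunE. Qed.

Lemma kco_inj f g : (forall b, size b = 6 -> kco f b = kco g b) -> f = g.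
Proof.
move=> h; apply/funext => n; apply/ffunP => S; have [b sb ->] := set_of_maskP S.
by have := congr1 (fun u => u n) (h b sb).
Qed.

Lemma kco_wedge f g b : kco (cauchy (@wedge K^o 6) f g) b =
  feval (fun m => smul (kco f m.1) (kco g m.2)) (wedgeF 6 b).
Proof.
apply/funext => n; rewrite /kco /cauchy sum_ffunE.
under eq_bigr do rewrite wedge_st.
rewrite exchange_big /feval fct_sumE; apply: eq_bigr => m _.
by rewrite fctE /smul /cauchy -mulr_sumr.
Qed.

(** Differentiating by a generator and multiplying it back fixes the monomials containing it, as the
    two signs cancel, and kills the others; summing over the generators counts the degree. *)
Lemma k16_eulerE f n S : k16_euler f n S = #|S|%:R * f n S.
Proof.
pose G (j : 'I_(3 + 3)) : K^o := if (j : 'I_6) \in S then f n S else 0.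
have gE (j : 'I_6) : wedge (mon K^o [set j]) (dpart j (f n)) S = G j.
  rewrite wedge_mon1 /G; case: ifP => // jS; rewrite ffunE !inE eqxx /= setD1K //.
  have -> : #|[set k in S :\ j | (k < j)%N]| = #|[set k in S | (k < j)%N]|.
    by apply: eq_card => k; rewrite !inE; case: eqP => //= ->; rewrite ltnn andbF.
  by rewrite mulrA -expr2 sqrr_sign mul1r.
rewrite /k16_euler sum_ffunE.
under eq_bigr do rewrite ffunE !gE.
transitivity (\sum_(j : 'I_6) G j).
  by rewrite big_split [RHS](@big_split_ord _ _ _ 3 3).
by rewrite /G -big_mkcond /= sumr_const mulr_natl.
Qed.

Lemma kco_euler f b : size b = 6 ->
  kco (2%:R *: f - k16_euler f) b = (2 - (count id b)%:Z)%:~R *: kco f b.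
Proof.
move=> sb; apply/funext => n; rewrite kcoD kcoN kcoZ !fctE.
by rewrite {2}/kco k16_eulerE card_st // intrB scalerBl.
Qed.

Lemma kco_par f b : size b = 6 ->
  kco (k16_par f) b = (sgnz (count id b))%:~R *: kco f b.
Proof.
by move=> sb; apply/funext => n; rewrite /kco ffunE sgnzE fctE card_st.
Qed.

Lemma kco_pder (j : 'I_6) f b : kco (k16_pder j f) b = feval (kco f) (dpartF 6 j b).
Proof.
by apply/funext => n; rewrite /kco dpart_st /feval fct_sumE; apply: eq_bigr.
Qed.

Lemma size_dpartF j b m : m \in dpartF 6 j b -> size m.2 = 6.
Proof. by rewrite /dpartF; case: ifP => //= _; rewrite inE => /eqP ->. Qed.

Lemma kco_contr (i j : 'I_6) f g b :
  kco (cauchy (@wedge K^o 6) (k16_pder i (k16_par f)) (k16_pder j g)) b =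
  feval (bile (kco f) (kco g)) (contrF i j b).
Proof.
rewrite kco_wedge feval_bind; apply: eq_feval => m; rewrite feval_map.
rewrite (@eq_feval _ _ _ _ (fun a => smul (kco f a.1) (kco g a.2))) //.
rewrite feval_tens !kco_pder feval_bind; congr smul; apply: eq_big_seq => a.
move=> /size_dpartF sa.
by rewrite kco_par // feval_cons feval_nil addr0.
Qed.

Lemma kco_bracket f g b :
  kco (k16_bracket f g) b = feval (bile (kco f) (kco g)) (kbrF b).
Proof.
rewrite /k16_bracket feval_cat !kcoD kcoN kco_sum feval_flatten -big_ord_iota.
congr (_ + _); last first.
  by apply: eq_bigr => i _; rewrite kcoD feval_cat !kco_contr.
rewrite !kco_wedge feval_bind /feval -sumrB; apply: eq_big_seq => m.
move=> /size_wedgeF[s1 s2]; rewrite -scalerBr; congr (_ *: _).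
rewrite !kco_euler // !kco_tder smulZl smulZr !big_cons big_nil addr0.
by rewrite -scaleNr -intrN opprB.
Qed.

End K16Coordinates.

(** * The bracket of E(1,6) in coordinates *)

(** The index of the 3-form coefficient from which [vf_of_form] reads its j-th component. *)
Definition mC1 (j : nat) : mask := mdiff 4 (mfull 4) (munit 4 j).

(* Structure constants of the operations of the same names, in the coordinates
   xco, qco and wco below; those of sl4_int and L2_int are doubled to be integral.
   The coefficient of x_i in a component of i_X w is given by sc_contr. *)
Definition sc_sl4_bracket (k : nat * nat) : seq (int * ((nat * nat) * (nat * nat))) :=
  flatten [seq [:: (1%Z, ((k.1, l), (l, k.2))); (-1, ((l, k.2), (k.1, l)))]
          | l <- iota 0 4].
Definition sc_sl4_S2 (k : nat * nat) : seq (int * ((nat * nat) * (nat * nat))) :=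
  flatten [seq [:: (1%Z, ((k.1, l), (l, k.2))); (1%Z, ((k.2, l), (l, k.1)))]
          | l <- iota 0 4].
Definition sc_contr (i : nat) (c : mask) : seq (int * ((nat * nat) * mask)) :=
  flatten [seq fmap (pair (i, a)) (dpartF 4 a c) | a <- iota 0 4].
Definition sc_sl4_lie (c : mask) : seq (int * ((nat * nat) * mask)) :=
  flatten [seq (if nth false c i
                then fscale (sgnz (mlt 4 c i)) (sc_contr i (mdiff 4 c (munit 4 i)))
                else [::]) | i <- iota 0 4].
Definition sc_sl4_int (k : nat * nat) : seq (int * ((nat * nat) * mask)) :=
  sc_contr k.2 (munit 4 k.1) ++ sc_contr k.1 (munit 4 k.2).
Definition sc_S2_L2 (k : nat * nat) : seq (int * ((nat * nat) * mask)) :=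
  fscale (sgnz k.2) (fbind (wedgeF 4 (mC1 k.2)) (fun m =>
    [seq (1%Z, ((a, k.1), m.2)) | a <- iota 0 4 & m.1 == munit 4 a])).
Definition sc_L2_int (k : nat * nat) : seq (int * (mask * mask)) :=
  fscale (sgnz k.2) (fbind (wedgeF 4 (mC1 k.2)) (fun m =>
    fmap (fun d => (d, m.2)) (dpartF 4 k.1 m.1)
    ++ fscale (-1) (fmap (pair m.1) (dpartF 4 k.1 m.2)))).

(** * Structure constants of the operations on sl_4, S^2 and Lambda^2 *)

Section PolynomialCoefficients.
Variable K : numFieldType.
Local Notation poly := {mpoly K[4]}.
Local Notation vfield := {ffun 'I_4 -> poly}.
Local Notation form := {ffun {set 'I_4} -> poly}.
Implicit Types (p q : poly) (X Y : vfield) (u v w : form).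

(** Coordinates are derivatives at the origin rather than monomial coefficients, so that the product
    rule applies directly. Thus [qco] is symmetric in its indices, and on the diagonal it is twice
    the coefficient of the square. *)
Definition xco X (k : nat * nat) : K^o := ((X (inord k.2))^`M(inord k.1))@_0%MM.
Definition qco p (k : nat * nat) : K^o := (p^`M(inord k.1)^`M(inord k.2))@_0%MM.
Definition wco w (c : mask) : K^o := (w (set_of_mask 4 c))@_0%MM.

Lemma c0_homog d p : p \is d.+1.-homog -> p@_0%MM = 0.
Proof. by move=> hp; rewrite (dhomog_nemf_coeff hp) //= mdeg0. Qed.

Lemma c0M p q : (p * q)@_0%MM = p@_0%MM * q@_0%MM.
Proof. exact: rmorphM. Qed.

Lemma c0_int (z : int) p : (z%:~R * p)@_0%MM = z%:~R * p@_0%MM.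
Proof. by rewrite c0M rmorph_int. Qed.

Lemma mderiv_int (z : int) p i : (z%:~R * p)^`M(i) = z%:~R * p^`M(i).
Proof. by rewrite !mulrzl raddfMz. Qed.

Lemma deriv_c0M i p q :
  (p * q)^`M(i)@_0%MM = p^`M(i)@_0%MM * q@_0%MM + p@_0%MM * q^`M(i)@_0%MM.
Proof. by rewrite mderivM mcoeffD !c0M. Qed.

Lemma deriv2_c0M i j p q : p \is 1.-homog -> q \is 1.-homog ->
  (p * q)^`M(i)^`M(j)@_0%MM =
  p^`M(i)@_0%MM * q^`M(j)@_0%MM + p^`M(j)@_0%MM * q^`M(i)@_0%MM.
Proof.
move=> hp hq; rewrite mderivM linearD mcoeffD /= !deriv_c0M.
rewrite (c0_homog hp) (c0_homog hq) !(mulr0, mul0r) addr0 add0r.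
by rewrite mulrC.
Qed.

Lemma c0_deriv_sum (I : Type) (r : seq I) (F : I -> poly) i :
  (\sum_(a <- r) F a)^`M(i)@_0%MM = \sum_(a <- r) (F a)^`M(i)@_0%MM.
Proof. by rewrite [_^`M(i)]linear_sum raddf_sum. Qed.

Lemma app_c0 X p i : vf_linear X ->
  (vf_app X p)^`M(i)@_0%MM = \sum_a (X a)^`M(i)@_0%MM * p^`M(a)@_0%MM.
Proof.
move=> /forallP hX; rewrite c0_deriv_sum; apply: eq_bigr => a _.
by rewrite deriv_c0M (c0_homog (hX a)) mul0r addr0.
Qed.

Lemma app2_c0 X p i j : vf_linear X -> p \is 2.-homog ->
  (vf_app X p)^`M(i)^`M(j)@_0%MM =
  \sum_a ((X a)^`M(i)@_0%MM * p^`M(a)^`M(j)@_0%MM +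
          (X a)^`M(j)@_0%MM * p^`M(a)^`M(i)@_0%MM).
Proof.
move=> /forallP hX hp; rewrite [_^`M(i)]linear_sum c0_deriv_sum; apply: eq_bigr => a _.
by rewrite deriv2_c0M //; apply: mderiv_homog.
Qed.

Lemma xco_bracket X Y (i j : 'I_4) : vf_linear X -> vf_linear Y ->
  xco (vf_bracket X Y) (i : nat, j : nat) =
  feval (fun k => xco X k.1 * xco Y k.2 : K^o) (sc_sl4_bracket (i : nat, j : nat)).
Proof.
move=> hX hY; rewrite feval_flatten -big_ord_iota /xco /= !inord_val ffunE.
rewrite linearB mcoeffB /= !app_c0 // -sumrB; apply: eq_bigr => a _.
rewrite !feval_cons feval_nil addr0 /= !inord_val scale1r scaleN1r.
by rewrite [X in _ - X]mulrC.
Qed.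

Lemma qco_app X p (i j : 'I_4) : vf_linear X -> p \is 2.-homog ->
  qco (vf_app X p) (i : nat, j : nat) =
  feval (fun k => xco X k.1 * qco p k.2 : K^o) (sc_sl4_S2 (i : nat, j : nat)).
Proof.
move=> hX hp; rewrite feval_flatten -big_ord_iota /qco /= !inord_val app2_c0 //.
apply: eq_bigr => a _.
by rewrite !feval_cons feval_nil addr0 /xco /= !inord_val !scale1r.
Qed.

Lemma c0_dpart w (a : 'I_4) c :
  (dpart a w (set_of_mask 4 c))@_0%MM = feval (wco w) (dpartF 4 a c).
Proof.
by rewrite dpart_st raddf_sum; apply: eq_bigr => m _ /=; rewrite c0_int.
Qed.

Lemma contr_c0 X w (i : 'I_4) c : vf_linear X -> is_form 2 0 w ->
  (contr X w (set_of_mask 4 c))^`M(i)@_0%MM =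
  feval (fun k => xco X k.1 * wco w k.2 : K^o) (sc_contr i c).
Proof.
move=> /forallP hX hw; rewrite feval_flatten -big_ord_iota ffunE c0_deriv_sum.
apply: eq_bigr => a _; rewrite deriv_c0M (c0_homog (hX a)) mul0r addr0.
rewrite c0_dpart feval_map /feval mulr_sumr; apply: eq_bigr => m _ /=.
by rewrite /xco /= !inord_val mulrCA.
Qed.

(** A constant form is closed, so its Lie derivative reduces to d(i_X w). *)
Lemma extd_contr_c0 X w c : vf_linear X -> is_form 2 0 w ->
  wco (lieD X w) c = feval (fun k => xco X k.1 * wco w k.2 : K^o) (sc_sl4_lie c).
Proof.
move=> hX hw; rewrite /lieD (extd_const hw).
have -> : contr X 0 = 0.
  apply/ffunP => S; rewrite !ffunE; apply: big1 => j _.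
  by rewrite !ffunE mulr0 if_same mulr0.
rewrite add0r feval_flatten -big_ord_iota /wco /extd sum_ffunE raddf_sum.
apply: eq_bigr => i _ /=; rewrite wedge_mon1 inE; case: ifP => _; last first.
  by rewrite mcoeff0 feval_nil.
rewrite feval_scale -contr_c0 // st_mdiff st_munit sgnzE -card_lt_st.
by rewrite c0M rmorphXn rmorphN1 [form_pder _ _ _]ffunE.
Qed.

(** With alpha = i_X w, the integral is half of the sum of x_a alpha_a, and its second derivative
    along x_i and x_j is half of the sum of d_i alpha_j and d_j alpha_i. The factor 2 clears this
    half. *)
Lemma qco_int X w (i j : 'I_4) : vf_linear X -> is_form 2 0 w ->
  2%:R *: qco (form_int 1 1 (contr X w) set0) (i : nat, j : nat) =
  feval (fun k => xco X k.1 * wco w k.2 : K^o) (sc_sl4_int (i : nat, j : nat)).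
Proof.
move=> hX hw; have hc := contr_form hX hw.
rewrite feval_cat /= -!contr_c0 // !st_munit /qco /= !inord_val ffunE !linearZ /=.
rewrite scalerA mulVf ?pnatr_eq0 // scale1r.
have d0 (a : 'I_4) : dpart a (contr X w) set0 = contr X w [set a].
  rewrite ffunE inE finset.setU0; set S := [set k in _ | _].
  have -> : S = set0 by apply/setP => k; rewrite !inE.
  by rewrite cards0 mul1r.
have -> : contr (euler K 4) (contr X w) set0 = \sum_a 'X_a * contr X w [set a].
  by rewrite ffunE; apply: eq_bigr => a _; rewrite d0 ffunE.
rewrite [_^`M(i)]linear_sum c0_deriv_sum.
have dX (a b : 'I_4) : ('X_a : poly)^`M(b)@_0%MM = (a == b)%:R.
  rewrite mderivX mnm1E mcoeffZ; case: eqP => [->|_]; last by rewrite mul0r.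
  by rewrite -{1}[U_(b)%MM]add0m addmK mpolyX0 mcoeff1 eqxx mulr1.
have dsum b (F : 'I_4 -> K) : \sum_a (a == b)%:R * F a = F b.
  rewrite (bigD1 b) //= eqxx mul1r big1 ?addr0 // => a /negPf ->.
  by rewrite mul0r.
under eq_bigr => a _.
  rewrite deriv2_c0M ?(is_form_homog _ hc) //; last by rewrite dhomogX /= mdeg1.
  rewrite !dX; over.
by rewrite big_split /= !dsum addrC.
Qed.

Lemma mC1E (j : 'I_4) : set_of_mask 4 (mC1 j) = [set~ j].
Proof. by rewrite st_mdiff st_mfull st_munit setTD. Qed.

Lemma wedge_c0 u v c : wco (wedge u v) c =
  feval (fun m => wco u m.1 * wco v m.2 : K^o) (wedgeF 4 c).
Proof.
rewrite /wco wedge_st raddf_sum; apply: eq_bigr => m _ /=.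
by rewrite c0_int c0M.
Qed.

Lemma deriv_wedge_c0 u v c i :
  (wedge u v (set_of_mask 4 c))^`M(i)@_0%MM =
  feval (fun m => (u (set_of_mask 4 m.1))^`M(i)@_0%MM * wco v m.2 +
                  wco u m.1 * (v (set_of_mask 4 m.2))^`M(i)@_0%MM : K^o) (wedgeF 4 c).
Proof.
rewrite wedge_st c0_deriv_sum; apply: eq_bigr => m _ /=.
by rewrite mderiv_int c0_int deriv_c0M.
Qed.

Lemma wco1 k w c : is_form k 1 w -> wco w c = 0.
Proof. by move=> hw; apply: c0_homog (is_form_homog _ hw). Qed.

Lemma deriv_wedge10 k l u v c i : is_form k 1 u -> is_form l 0 v ->
  (wedge u v (set_of_mask 4 c))^`M(i)@_0%MM =
  feval (fun m => (u (set_of_mask 4 m.1))^`M(i)@_0%MM * wco v m.2 : K^o) (wedgeF 4 c).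
Proof.
move=> hu hv; rewrite deriv_wedge_c0; apply: (@eq_feval _ K^o) => m.
by rewrite (wco1 _ hu) mul0r addr0.
Qed.

Lemma deriv_wedge01 k l u v c i : is_form k 0 u -> is_form l 1 v ->
  (wedge u v (set_of_mask 4 c))^`M(i)@_0%MM =
  feval (fun m => wco u m.1 * (v (set_of_mask 4 m.2))^`M(i)@_0%MM : K^o) (wedgeF 4 c).
Proof.
move=> hu hv; rewrite deriv_wedge_c0; apply: (@eq_feval _ K^o) => m.
by rewrite (wco1 _ hv) mulr0 add0r.
Qed.

Lemma xco_vf_of_form w (i j : 'I_4) : xco (vf_of_form w) (i : nat, j : nat) =
  (sgnz j)%:~R * (w (set_of_mask 4 (mC1 j)))^`M(i)@_0%MM.
Proof.
rewrite /xco /= !inord_val ffunE mC1E -signr_odd sgnzE -[in RHS]signr_odd.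
by rewrite !mulr_sign; case: odd; rewrite ?linearN ?mcoeffN.
Qed.

Lemma deriv_d0_c0 p (i : 'I_4) c : size c = 4 ->
  (extd (form0 p) (set_of_mask 4 c))^`M(i)@_0%MM =
  \sum_(a <- iota 0 4 | c == munit 4 a) qco p (a, i : nat).
Proof.
move=> sc; rewrite /extd sum_ffunE c0_deriv_sum [RHS]big_mkcond -big_ord_iota.
apply: eq_bigr => a _; rewrite wedge_mon1.
have -> : (c == munit 4 a) = (set_of_mask 4 c == [set a]).
  apply/eqP/eqP => [->|]; first exact: st_munit.
  by rewrite -st_munit => e; rewrite -(set_of_maskK sc) e set_of_maskK // size_mkseq.
rewrite /qco /= !inord_val; case: eqP => [->|ne]; last first.
  case: ifP => aS; last by rewrite linear0 mcoeff0.
  rewrite [form_pder _ _ _]ffunE [form0 _ _]ffunE ifF.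
    by rewrite linear0 mulr0 linear0 mcoeff0.
  by apply/negP => /eqP e; apply: ne; rewrite -(setD1K aS) e finset.setU0.
rewrite set11 setDv [form_pder _ _ _]ffunE [form0 _ _]ffunE eqxx.
have -> : [set k in [set a] | (k < a)%N] = set0.
  by apply/setP => k; rewrite !inE; case: eqP => //= ->; rewrite ltnn.
by rewrite cards0 mul1r.
Qed.

Lemma xco_S2_L2 p w (i j : 'I_4) : p \is 2.-homog -> is_form 2 0 w ->
  xco (vf_of_form (wedge (extd (form0 p)) w)) (i : nat, j : nat) =
  feval (fun k => qco p k.1 * wco w k.2 : K^o) (sc_S2_L2 (i : nat, j : nat)).
Proof.
move=> hp hw; rewrite xco_vf_of_form feval_scale feval_bind.
rewrite (deriv_wedge10 _ _ (extd_form (form0_form hp)) hw); congr (_ * _).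
apply: eq_big_seq => m /size_wedgeF[s1 s2]; congr (_ * _).
rewrite deriv_d0_c0 // /feval big_map big_filter mulr_suml.
by apply: eq_bigr => a _; rewrite scale1r.
Qed.

(** The contraction of a constant form with the Euler field is a sum of terms x_a times a constant,
    and the derivative along x_i isolates a = i. The factor 1/2 is 1/(k+m) for k = 2, m = 0. *)
Lemma deriv_int_c0 w (i : 'I_4) c :  is_form 2 0 w ->
  (form_int 2 0 w (set_of_mask 4 c))^`M(i)@_0%MM = 2%:R^-1 * feval (wco w) (dpartF 4 i c).
Proof.
move=> hw; rewrite ffunE !linearZ /= -c0_dpart addn0; congr (_ * _).
rewrite ffunE c0_deriv_sum (bigD1 i) //= big1 ?addr0 => [|a /negPf nai].
  rewrite deriv_c0M ffunE mderivX mnm1E eqxx scale1r.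
  rewrite -{1}[U_(i)%MM]add0m addmK mpolyX0 mcoeff1 eqxx mul1r.
  by rewrite (mderiv_homog0 _ (dpart_homog _ _ hw)) mcoeff0 mulr0 addr0.
rewrite deriv_c0M ffunE mderivX mnm1E nai scale0r mcoeff0 mul0r add0r.
by rewrite (mderiv_homog0 _ (dpart_homog _ _ hw)) mcoeff0 mulr0.
Qed.

Lemma xco_L2_int u v (i j : 'I_4) : is_form 2 0 u -> is_form 2 0 v ->
  2%:R *: xco (vf_of_form (wedge (form_int 2 0 u) v - wedge u (form_int 2 0 v)))
    (i : nat, j : nat) =
  feval (fun k => wco u k.1 * wco v k.2 : K^o) (sc_L2_int (i : nat, j : nat)).
Proof.
move=> hu hv; rewrite xco_vf_of_form feval_scale feval_bind.
have subE (a b : form) S : (a - b) S = a S - b S by rewrite !ffunE.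
rewrite subE [_^`M(_)]linearB mcoeffB /= (deriv_wedge10 _ _ (form_int_form hu) hv).
rewrite (deriv_wedge01 _ _ hu (form_int_form hv)).
rewrite -[LHS]/(2%:R * _) mulrCA; congr (_ * _); rewrite /feval -sumrB mulr_sumr.
apply: eq_bigr => m _.
rewrite -[X in _ = _ *: X]/(feval (fun k => wco u k.1 * wco v k.2 : K^o) _).
rewrite feval_cat feval_scale !feval_map.
rewrite !deriv_int_c0 //.
have -> : feval ((fun k => wco u k.1 * wco v k.2 : K^o) \o pair^~ m.2.2)
    (dpartF 4 i m.2.1) = feval (wco u) (dpartF 4 i m.2.1) * wco v m.2.2.
  by rewrite /feval mulr_suml; apply: eq_bigr => d _; rewrite -scalerAl.
have -> : feval ((fun k => wco u k.1 * wco v k.2 : K^o) \o pair m.2.1)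
    (dpartF 4 i m.2.2) = wco u m.2.1 * feval (wco v) (dpartF 4 i m.2.2).
  by rewrite /feval mulr_sumr; apply: eq_bigr => d _; rewrite -scalerAr.
rewrite /GRing.scale /=; move: (feval (wco u) _ : K) (feval (wco v) _ : K) => x y.
move: (wco u _ : K) (wco v _ : K) (m.1%:~R : K) => x' y' z.
by field.
Qed.

End PolynomialCoefficients.

(** * Passage from vectors to series of vectors *)

Section SeriesCoordinate.
Variables (K : numFieldType) (W : lmodType K) (c : {linear W -> K^o}).
Implicit Types f g : nat -> W.

Definition cser f : nat -> K^o := fun n => c (f n).

Lemma cserD f g : cser (f + g) = cser f + cser g.
Proof. by apply/funext => n; rewrite /cser !fctE linearD. Qed.

Lemma cserN f : cser (- f) = - cser f.
Proof. by apply/funext => n; rewrite /cser !fctE linearN. Qed.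

Lemma cserZ a f : cser (a *: f) = a *: cser f.
Proof. by apply/funext => n; rewrite /cser !fctE linearZ. Qed.

Lemma cser_tder f : cser (tder f) = tder (cser f).
Proof. by apply/funext => n; rewrite /cser /tder linearZ. Qed.

Lemma cser_scal (f : nat -> K^o) g : cser (cauchy (@scal K W) f g) = smul f (cser g).
Proof.
apply/funext => n; rewrite /cser /cauchy linear_sum; apply: eq_bigr => i _ /=.
by rewrite linearZ.
Qed.

(** The weights 1/2 and 3/2 leave the coefficients 1/2 and -1/2 on f'v; multiplied by 4 they are the
    entries 2 and -2 of [ebrF]. *)
Lemma cser_density a (f : nat -> K^o) g : cser (W1_density a f g) =
  (1 - a) *: smul (tder f) (cser g) + smul f (tder (cser g)).
Proof.
rewrite /W1_density cserD cserN cserZ cser_tder !cser_scal tder_smul.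
by rewrite scalerBl scale1r addrAC.
Qed.

(** Structure constants valid for vectors are valid for series, coefficient by coefficient in t. The
    scalar [a] clears denominators: it is 2 for [sl4_int] and [L2_int], and 1 for the other
    operations. *)
Lemma cser_cauchy (U V : Type) (k k' : Type) (b : U -> V -> W)
    (al : k -> U -> K^o) (be : k' -> V -> K^o) a sc
    (f : nat -> U) (g : nat -> V) :
  (forall u v, a *: c (b u v) = feval (fun m => al m.1 u * be m.2 v : K^o) sc) ->
  a *: cser (cauchy b f g) =
  feval (fun m => smul (fun n => al m.1 (f n)) (fun n => be m.2 (g n))) sc.
Proof.
move=> h; apply/funext => n; rewrite /cser fctE /cauchy linear_sum scaler_sumr.
under eq_bigr do rewrite h.
rewrite exchange_big /feval fct_sumE; apply: eq_bigr => m _ /=.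
by rewrite fctE /smul /cauchy scaler_sumr.
Qed.

End SeriesCoordinate.

(* The components W_1, sl_4, S^2 and Lambda^2 of E(1,6), in this order. *)
Definition var : eqType := ((unit + nat * nat) + (nat * nat + mask))%type.
Definition vW : var := inl (inl tt).
Definition vX (k : nat * nat) : var := inl (inr k).
Definition vq (k : nat * nat) : var := inr (inl k).
Definition vw (c : mask) : var := inr (inr c).

Definition emb k k' (a : k -> var) (d : nat) (b : k' -> var) (e : nat)
    (l : seq (int * (k * k'))) : seq (int * ((var * nat) * (var * nat))) :=
  fmap (fun m => ((a m.1, d), (b m.2, e))) l.
(** For terms of [x, y] in which the operation takes its first argument from y and its second from
    x: the factors are exchanged so that those of x stay on the left. *)
Definition embC k k' (a : k -> var) (d : nat) (b : k' -> var) (e : nat)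
    (l : seq (int * (k * k'))) : seq (int * ((var * nat) * (var * nat))) :=
  fmap (fun m => ((b m.2, e), (a m.1, d))) l.

Definition vok (v : var) : bool :=
  match v with
  | inl (inr k) | inr (inl k) => (k.1 < 4)%N && (k.2 < 4)%N
  | inr (inr c) => size c == 4
  | _ => true
  end.

(* Coordinates of a bracket, multiplied by 4 to make all coefficients integral. *)
Definition ebrF (v : var) : seq (int * ((var * nat) * (var * nat))) :=
  match v with
  | inl (inl _) =>
      [:: (4%Z, ((vW, 0%N), (vW, 1%N))); (- 4%Z, ((vW, 1%N), (vW, 0%N)))]
      ++ fscale 4 (emb vw 0 vw 0 (wedgeF 4 (mfull 4)))
  | inl (inr k) =>
      fscale 4 (emb vX 0 vX 0 (sc_sl4_bracket k))
      ++ [:: (4%Z, ((vW, 0%N), (vX k, 1%N))); (- 4%Z, ((vX k, 1%N), (vW, 0%N)))]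
      ++ fscale (- 4%Z) (emb vq 0 vw 0 (sc_S2_L2 k) ++ embC vq 0 vw 0 (sc_S2_L2 k))
      ++ emb vw 0 vw 1 (sc_L2_int k) ++ fscale (- 1%Z) (emb vw 1 vw 0 (sc_L2_int k))
  | inr (inl k) =>
      [:: (2%Z, ((vW, 1%N), (vq k, 0%N))); (4%Z, ((vW, 0%N), (vq k, 1%N)));
          (- 2%Z, ((vq k, 0%N), (vW, 1%N))); (- 4%Z, ((vq k, 1%N), (vW, 0%N)))]
      ++ fscale 4 (emb vX 0 vq 0 (sc_sl4_S2 k))
      ++ fscale (- 4%Z) (embC vX 0 vq 0 (sc_sl4_S2 k))
      ++ fscale 2 (emb vX 1 vw 0 (sc_sl4_int k))
      ++ fscale (- 2%Z) (embC vX 1 vw 0 (sc_sl4_int k))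
  | inr (inr c) =>
      [:: (- 2%Z, ((vW, 1%N), (vw c, 0%N))); (4%Z, ((vW, 0%N), (vw c, 1%N)));
          (2%Z, ((vw c, 0%N), (vW, 1%N))); (- 4%Z, ((vw c, 1%N), (vW, 0%N)))]
      ++ fscale 4 (emb vX 0 vw 0 (sc_sl4_lie c))
      ++ fscale (- 4%Z) (embC vX 0 vw 0 (sc_sl4_lie c))
  end.

(** * Assembly of the bracket of E(1,6) from its components *)

Section E16Coordinates.
Variable K : numFieldType.
Local Notation S2 := (dhomog 4 K 2).
Local Notation ser := (nat -> K^o).

Definition Xco (k : nat * nat) (X : sl4 K) : K^o := xco X k.
Definition Qco (k : nat * nat) (p : S2) : K^o := qco p k.
Definition Wco (c : mask) (w : L2 K) : K^o := wco w c.

Lemma Xco_linear k : linear (Xco k).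
Proof.
by move=> a X Y; rewrite /Xco /xco !ffunE linearP mcoeffD mcoeffZ.
Qed.
HB.instance Definition _ k :=
  GRing.isLinear.Build K (sl4 K) K^o _ (Xco k) (Xco_linear k).

Lemma Qco_linear k : linear (Qco k).
Proof. by move=> a p q; rewrite /Qco /qco !linearP. Qed.
HB.instance Definition _ k :=
  GRing.isLinear.Build K S2 K^o _ (Qco k) (Qco_linear k).

Lemma Wco_linear c : linear (Wco c).
Proof. by move=> a u v; rewrite /Wco /wco !ffunE mcoeffD mcoeffZ. Qed.
HB.instance Definition _ c :=
  GRing.isLinear.Build K (L2 K) K^o _ (Wco c) (Wco_linear c).

Definition eco (x : E16 K) (v : var) : ser :=
  match v with
  | inl (inl _) => x.1.1
  | inl (inr k) => cser (Xco k) x.1.2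
  | inr (inl k) => cser (Qco k) x.2.1
  | inr (inr c) => cser (Wco c) x.2.2
  end.

Lemma eco_linear v a x y : eco (a *: x + y) v = a *: eco x v + eco y v.
Proof.
by case: v => [[u|k]|[k|c]] /=; rewrite ?cserD ?cserZ.
Qed.

Lemma ord_pair (k : nat * nat) : (k.1 < 4)%N && (k.2 < 4)%N ->
  exists i j : 'I_4, k = (i : nat, j : nat).
Proof. by case: k => i j /andP[/= hi hj]; exists (Ordinal hi), (Ordinal hj). Qed.

Lemma S2_homog (p : S2) : (p : {mpoly K[4]}) \is 2.-homog.
Proof. exact: dhomog_is_dhomog. Qed.

Lemma Xco_bracket k X Y : vok (vX k) -> Xco k (sl4_bracket X Y) =
  feval (fun m => Xco m.1 X * Xco m.2 Y : K^o) (sc_sl4_bracket k).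
Proof.
by move=> /ord_pair[i [j ->]]; apply: xco_bracket; exact: sl4_linear.
Qed.

Lemma Qco_S2 k (X : sl4 K) p : vok (vq k) -> Qco k (sl4_S2 X p) =
  feval (fun m => Xco m.1 X * Qco m.2 p : K^o) (sc_sl4_S2 k).
Proof.
by move=> /ord_pair[i [j ->]]; apply: qco_app; [exact: sl4_linear|exact: S2_homog].
Qed.

Lemma Wco_lie c (X : sl4 K) w : Wco c (sl4_lie X w) =
  feval (fun m => Xco m.1 X * Wco m.2 w : K^o) (sc_sl4_lie c).
Proof. by apply: extd_contr_c0; [exact: sl4_linear|exact: L2_formP]. Qed.

Lemma Qco_int k (X : sl4 K) w : vok (vq k) -> 2%:R *: Qco k (sl4_int X w) =
  feval (fun m => Xco m.1 X * Wco m.2 w : K^o) (sc_sl4_int k).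
Proof.
by move=> /ord_pair[i [j ->]]; apply: qco_int; [exact: sl4_linear|exact: L2_formP].
Qed.

Lemma Xco_S2_L2 k (p : S2) w : vok (vX k) -> Xco k (S2_L2 p w) =
  feval (fun m => Qco m.1 p * Wco m.2 w : K^o) (sc_S2_L2 k).
Proof.
move=> /ord_pair[i [j ->]].
by apply: xco_S2_L2; [exact: S2_homog|exact: L2_formP].
Qed.

Lemma Xco_L2_int k (u v : L2 K) : vok (vX k) -> 2%:R *: Xco k (L2_int u v) =
  feval (fun m => Wco m.1 u * Wco m.2 v : K^o) (sc_L2_int k).
Proof. by move=> /ord_pair[i [j ->]]; apply: xco_L2_int; exact: L2_formP. Qed.

Lemma L2_wedgeE (u v : L2 K) : L2_wedge u v =
  feval (fun m => Wco m.1 u * Wco m.2 v : K^o) (wedgeF 4 (mfull 4)).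
Proof. by rewrite -[RHS]wedge_c0 /wco st_mfull. Qed.

Lemma feval_embC k k' (a : k -> var) d (b : k' -> var) e x y l :
  feval (bile (eco x) (eco y)) (embC a d b e l) =
  feval (bile (eco y) (eco x)) (emb a d b e l).
Proof. by rewrite !feval_map; apply: eq_feval => m; rewrite /= /bile smulC. Qed.

Lemma cser_bracket k x y : vok (vX k) ->
  feval (bile (eco x) (eco y)) (emb vX 0 vX 0 (sc_sl4_bracket k)) =
  cser (Xco k) (cauchy (@sl4_bracket K) x.1.2 y.1.2).
Proof.
move=> hk; rewrite feval_map -[RHS]scale1r
  (@cser_cauchy _ _ _ _ _ _ _ _ Xco Xco _ (sc_sl4_bracket k)); last first.
  by move=> u v; rewrite ?scale1r; apply: Xco_bracket.
by [].
Qed.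

Lemma cser_S2 k x y : vok (vq k) ->
  feval (bile (eco x) (eco y)) (emb vX 0 vq 0 (sc_sl4_S2 k)) =
  cser (Qco k) (cauchy (@sl4_S2 K) x.1.2 y.2.1).
Proof.
move=> hk; rewrite feval_map -[RHS]scale1r
  (@cser_cauchy _ _ _ _ _ _ _ _ Xco Qco _ (sc_sl4_S2 k)); last first.
  by move=> u v; rewrite ?scale1r; apply: Qco_S2.
by [].
Qed.

Lemma cser_lie c x y :
  feval (bile (eco x) (eco y)) (emb vX 0 vw 0 (sc_sl4_lie c)) =
  cser (Wco c) (cauchy (@sl4_lie K) x.1.2 y.2.2).
Proof.
rewrite feval_map -[RHS]scale1r
  (@cser_cauchy _ _ _ _ _ _ _ _ Xco Wco _ (sc_sl4_lie c)); last first.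
  by move=> u v; rewrite ?scale1r; apply: Wco_lie.
by [].
Qed.

Lemma cser_int k x y : vok (vq k) ->
  feval (bile (eco x) (eco y)) (emb vX 1 vw 0 (sc_sl4_int k)) =
  2%:R *: cser (Qco k) (cauchy (@sl4_int K) (tder x.1.2) y.2.2).
Proof.
move=> hk; rewrite feval_map
  (@cser_cauchy _ _ _ _ _ _ _ _ Xco Wco _ (sc_sl4_int k)); last first.
  by move=> u v; rewrite ?scale1r; apply: Qco_int.
by apply: eq_feval => m; rewrite /bile /sere /= -cser_tder.
Qed.

Lemma cser_S2_L2 k x y : vok (vX k) ->
  feval (bile (eco x) (eco y)) (emb vq 0 vw 0 (sc_S2_L2 k)) =
  cser (Xco k) (cauchy (@S2_L2 K) x.2.1 y.2.2).
Proof.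
move=> hk; rewrite feval_map -[RHS]scale1r
  (@cser_cauchy _ _ _ _ _ _ _ _ Qco Wco _ (sc_S2_L2 k)); last first.
  by move=> u v; rewrite ?scale1r; apply: Xco_S2_L2.
by [].
Qed.

Lemma cser_L2_int01 k x y : vok (vX k) ->
  feval (bile (eco x) (eco y)) (emb vw 0 vw 1 (sc_L2_int k)) =
  2%:R *: cser (Xco k) (cauchy (@L2_int K) x.2.2 (tder y.2.2)).
Proof.
move=> hk; rewrite feval_map
  (@cser_cauchy _ _ _ _ _ _ _ _ Wco Wco _ (sc_L2_int k)); last first.
  by move=> u v; rewrite ?scale1r; apply: Xco_L2_int.
by apply: eq_feval => m; rewrite /bile /sere /= -cser_tder.
Qed.

Lemma cser_L2_int10 k x y : vok (vX k) ->
  feval (bile (eco x) (eco y)) (emb vw 1 vw 0 (sc_L2_int k)) =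
  2%:R *: cser (Xco k) (cauchy (@L2_int K) (tder x.2.2) y.2.2).
Proof.
move=> hk; rewrite feval_map
  (@cser_cauchy _ _ _ _ _ _ _ _ Wco Wco _ (sc_L2_int k)); last first.
  by move=> u v; rewrite ?scale1r; apply: Xco_L2_int.
by apply: eq_feval => m; rewrite /bile /sere /= -cser_tder.
Qed.

Lemma cser_L2_wedge x y :
  feval (bile (eco x) (eco y)) (emb vw 0 vw 0 (wedgeF 4 (mfull 4))) =
  cauchy (@L2_wedge K) x.2.2 y.2.2.
Proof.
rewrite feval_map -[RHS]scale1r -[X in 1 *: X]/(cser (idfun : {linear K^o -> K^o}) _).
rewrite (@cser_cauchy _ _ _ _ _ _ _ _ Wco Wco _ (wedgeF 4 (mfull 4))) //.
by move=> u v; rewrite scale1r; apply: L2_wedgeE.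
Qed.

Lemma eco_bracket_vW x y :
  4%:R *: eco (e16_bracket x y) vW = feval (bile (eco x) (eco y)) (ebrF vW).
Proof.
rewrite /ebrF feval_cat feval_scale cser_L2_wedge !feval_cons feval_nil addr0.
case: x => [[f X] [p s]]; case: y => [[g Y] [q w]]; rewrite mulrNz.
rewrite -[bile _ _ (_, (vW, 1%N))]/(smul f (tder g)).
rewrite -[bile _ _ (_, (vW, 0%N))]/(smul (tder f) g).
rewrite -[eco _ _]/(smul f (tder g) - smul (tder f) g + cauchy (@L2_wedge K) s w) /=.
move: (smul f (tder g)) (smul (tder f) g) (cauchy _ s w) => a b c.
by apply/funext => n; rewrite !fctE /GRing.scale /=; ring.
Qed.

Lemma eco_bracket_vX k x y : vok (vX k) ->
  4%:R *: eco (e16_bracket x y) (vX k) = feval (bile (eco x) (eco y)) (ebrF (vX k)).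
Proof.
move=> hk; rewrite /ebrF !feval_cat !feval_scale !feval_cat feval_embC.
rewrite cser_bracket // !cser_S2_L2 // cser_L2_int01 // cser_L2_int10 //.
rewrite !feval_cons feval_nil addr0.
case: x => [[f X] [p s]]; case: y => [[g Y] [q w]]; rewrite !mulrNz.
rewrite -[bile _ _ (_, (vX k, 1%N))]/(smul f (tder (cser (Xco k) Y))).
rewrite -[bile _ _ (_, (vW, 0%N))]/(smul (tder (cser (Xco k) X)) g).
rewrite (smulC _ g) -!cser_tder [eco _ _]/=.
rewrite !(cserD, cserN, cserZ, cser_scal) /=.
move: (cser _ (cauchy _ X Y)) (smul f _) (smul g _) => a1 a2 a3.
move: (cser _ (cauchy _ p w)) (cser _ (cauchy _ q s)) => a4 a5.
move: (cser _ (cauchy _ s (tder w))) (cser _ (cauchy _ (tder s) w)) => a6 a7.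
by apply/funext => n; rewrite !fctE /GRing.scale /=; field.
Qed.

Lemma eco_bracket_vq k x y : vok (vq k) ->
  4%:R *: eco (e16_bracket x y) (vq k) = feval (bile (eco x) (eco y)) (ebrF (vq k)).
Proof.
move=> hk; rewrite /ebrF !feval_cat !feval_scale !feval_embC.
rewrite !cser_S2 // !cser_int // !feval_cons feval_nil addr0.
case: x => [[f X] [p s]]; case: y => [[g Y] [q w]]; rewrite !mulrNz.
rewrite -[bile _ _ (_, (vq k, 0%N))]/(smul (tder f) (cser (Qco k) q)).
rewrite -[bile _ _ (_, (vq k, 1%N))]/(smul f (tder (cser (Qco k) q))).
rewrite -[bile _ _ (_, (vW, 0%N))]/(smul (tder (cser (Qco k) p)) g).
rewrite -[bile _ _ (_, (vW, 1%N))]/(smul (cser (Qco k) p) (tder g)).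
rewrite (smulC _ g) (smulC _ (tder g)) [eco _ _]/=.
have := cser_density (Qco k) (1 / 2) f q; move: (W1_density _ f q) => d1.
have := cser_density (Qco k) (1 / 2) g p; move: (W1_density _ g p) => d2.
rewrite !(cserD, cserN) /= => -> ->.
move: (cser _ (cauchy _ X q)) (cser _ (cauchy _ Y p)) => a1 a2.
move: (cser _ (cauchy _ (tder X) w)) (cser _ (cauchy _ (tder Y) s)) => a3 a4.
move: (smul f _) (smul g _) (smul (tder f) _) (smul (tder g) _) => a5 a6 a7 a8.
by apply/funext => n; rewrite !fctE /GRing.scale /=; field.
Qed.

Lemma eco_bracket_vw c x y :
  4%:R *: eco (e16_bracket x y) (vw c) = feval (bile (eco x) (eco y)) (ebrF (vw c)).
Proof.
rewrite /ebrF !feval_cat !feval_scale !feval_embC !cser_lie !feval_cons feval_nil addr0.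
case: x => [[f X] [p s]]; case: y => [[g Y] [q w]]; rewrite !mulrNz.
rewrite -[bile _ _ (_, (vw c, 0%N))]/(smul (tder f) (cser (Wco c) w)).
rewrite -[bile _ _ (_, (vw c, 1%N))]/(smul f (tder (cser (Wco c) w))).
rewrite -[bile _ _ (_, (vW, 0%N))]/(smul (tder (cser (Wco c) s)) g).
rewrite -[bile _ _ (_, (vW, 1%N))]/(smul (cser (Wco c) s) (tder g)).
rewrite (smulC _ g) (smulC _ (tder g)) [eco _ _]/=.
have := cser_density (Wco c) (3 / 2) f w; move: (W1_density _ f w) => d1.
have := cser_density (Wco c) (3 / 2) g s; move: (W1_density _ g s) => d2.
rewrite !(cserD, cserN) /= => -> ->.
move: (cser _ (cauchy _ X w)) (cser _ (cauchy _ Y s)) => a1 a2.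
move: (smul f _) (smul g _) (smul (tder f) _) (smul (tder g) _) => a5 a6 a7 a8.
by apply/funext => n; rewrite !fctE /GRing.scale /=; field.
Qed.

Lemma eco_bracket v x y : vok v ->
  4%:R *: eco (e16_bracket x y) v = feval (bile (eco x) (eco y)) (ebrF v).
Proof.
case: v => [[[]|k]|[k|c]] hv; first exact: eco_bracket_vW.
- exact: eco_bracket_vX.
- exact: eco_bracket_vq.
exact: eco_bracket_vw.
Qed.

End E16Coordinates.

(** * The isomorphism *)

Definition mask_of_seq (n : nat) (s : seq nat) : mask := mkseq (fun i => i \in s) n.

(* The monomial xi_S of degree k contributes through A to the monomial of
   complementary degree supported on starm S. *)
Definition barm (b : mask) : mask := drop 3 b ++ take 3 b.
Definition starm (b : mask) : mask := map negb (barm b).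

(** The inversion number, which gives the sign of sorting a product of odd generators. *)
Fixpoint sinv (s : seq nat) : nat :=
  if s is x :: s' then (count (fun y => (y < x)%N) s' + sinv s')%N else 0%N.

(** Three signs: sorting the conjugated monomial, multiplying it by its complement, and sorting the
    volume element. The list 1, 2, 3, 4, 5, 0 gives the indices of xi_2, xi_3, xi_4 = eta_1, eta_2,
    eta_3, eta_4 = xi_1. *)
Definition sharp_sgn (c : mask) : int :=
  sgnz (sinv [seq ((i + 3) %% 6)%N | i <- iota 0 6 & nth false c i]
        + minv 6 (barm c) (map negb (barm c)) + sinv [:: 1; 2; 3; 4; 5; 0])%N.
(** Indexed by the target: the sign with which [A] sends the monomial [starm b] to b. *)
Definition A_sgn (b : mask) : int :=
  let c := starm b in
  sgnz ((count id c * (count id c).+1)./2) * sharp_sgn c.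

Definition mask6 (s : seq nat) : mask := mask_of_seq 6 s.
Definition vw2 (a b : nat) : var := vw (mask_of_seq 4 [:: a; b]).

(* Twice the coordinates of phi in degrees at most 3: sl_4 acts on the
   six-dimensional space Lambda^2 as so_6, where dx_2 dx_3, dx_2 dx_4, dx_2 dx_5
   go to xi_1, xi_2, xi_3 and the complementary forms to multiples of the eta_i;
   then S^2 is the self-dual half of Lambda^3 of this space. One monomial is
   listed for each pair of Hodge dual monomials of degree 3. *)
Definition phi_table : seq (mask * seq (int * var)) :=
  [:: (mask6 [::], [:: (1%Z, vW)]);
    (mask6 [:: 0], [:: (2%Z, vw2 0 1)]);
    (mask6 [:: 1], [:: (2%Z, vw2 0 2)]);
    (mask6 [:: 2], [:: (2%Z, vw2 0 3)]);
    (mask6 [:: 3], [:: (- 1%Z, vw2 2 3)]);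
    (mask6 [:: 4], [:: (1%Z, vw2 1 3)]);
    (mask6 [:: 5], [:: (- 1%Z, vw2 1 2)]);
    (mask6 [:: 0; 1], [:: (4%Z, vX (0, 3))]);
    (mask6 [:: 0; 2], [:: (- 4%Z, vX (0, 2))]);
    (mask6 [:: 0; 3], [:: (- 2%Z, vX (0, 0)); (- 2%Z, vX (1, 1))]);
    (mask6 [:: 0; 4], [:: (- 2%Z, vX (1, 2))]);
    (mask6 [:: 0; 5], [:: (- 2%Z, vX (1, 3))]);
    (mask6 [:: 1; 2], [:: (4%Z, vX (0, 1))]);
    (mask6 [:: 1; 3], [:: (- 2%Z, vX (2, 1))]);
    (mask6 [:: 1; 4], [:: (- 2%Z, vX (0, 0)); (- 2%Z, vX (2, 2))]);
    (mask6 [:: 1; 5], [:: (- 2%Z, vX (2, 3))]);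
    (mask6 [:: 2; 3], [:: (- 2%Z, vX (3, 1))]);
    (mask6 [:: 2; 4], [:: (- 2%Z, vX (3, 2))]);
    (mask6 [:: 2; 5], [:: (2%Z, vX (1, 1)); (2%Z, vX (2, 2))]);
    (mask6 [:: 3; 4], [:: (- 1%Z, vX (3, 0))]);
    (mask6 [:: 3; 5], [:: (1%Z, vX (2, 0))]);
    (mask6 [:: 4; 5], [:: (- 1%Z, vX (1, 0))]);
    (mask6 [:: 0; 1; 2], [:: (8%Z, vq (0, 0))]);
    (mask6 [:: 0; 1; 4], [:: (4%Z, vq (0, 1))]);
    (mask6 [:: 0; 1; 3], [:: (- 4%Z, vq (0, 2))]);
    (mask6 [:: 0; 2; 3], [:: (- 4%Z, vq (0, 3))]);
    (mask6 [:: 0; 4; 5], [:: (2%Z, vq (1, 1))]);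
    (mask6 [:: 0; 3; 5], [:: (- 2%Z, vq (1, 2))]);
    (mask6 [:: 0; 3; 4], [:: (2%Z, vq (1, 3))]);
    (mask6 [:: 1; 3; 5], [:: (- 2%Z, vq (2, 2))]);
    (mask6 [:: 1; 3; 4], [:: (2%Z, vq (2, 3))]);
    (mask6 [:: 2; 3; 4], [:: (2%Z, vq (3, 3))])].

(* Four times the inverse of phi. *)
Definition psi_table : seq (var * seq (int * mask)) :=
  [:: (vW, [:: (8%Z, mask6 [::])]);
    (vw2 0 1, [:: (4%Z, mask6 [:: 0])]);
    (vw2 0 2, [:: (4%Z, mask6 [:: 1])]);
    (vw2 0 3, [:: (4%Z, mask6 [:: 2])]);
    (vw2 2 3, [:: (- 8%Z, mask6 [:: 3])]);
    (vw2 1 3, [:: (8%Z, mask6 [:: 4])]);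
    (vw2 1 2, [:: (- 8%Z, mask6 [:: 5])]);
    (vX (0, 3), [:: (2%Z, mask6 [:: 0; 1])]);
    (vX (0, 2), [:: (- 2%Z, mask6 [:: 0; 2])]);
    (vX (1, 2), [:: (- 4%Z, mask6 [:: 0; 4])]);
    (vX (1, 3), [:: (- 4%Z, mask6 [:: 0; 5])]);
    (vX (0, 1), [:: (2%Z, mask6 [:: 1; 2])]);
    (vX (2, 1), [:: (- 4%Z, mask6 [:: 1; 3])]);
    (vX (2, 3), [:: (- 4%Z, mask6 [:: 1; 5])]);
    (vX (3, 1), [:: (- 4%Z, mask6 [:: 2; 3])]);
    (vX (3, 2), [:: (- 4%Z, mask6 [:: 2; 4])]);
    (vX (3, 0), [:: (- 8%Z, mask6 [:: 3; 4])]);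
    (vX (2, 0), [:: (8%Z, mask6 [:: 3; 5])]);
    (vX (1, 0), [:: (- 8%Z, mask6 [:: 4; 5])]);
    (vX (0, 0), [:: (- 2%Z, mask6 [:: 0; 3]); (- 2%Z, mask6 [:: 1; 4]);
                (- 2%Z, mask6 [:: 2; 5])]);
    (vX (1, 1), [:: (- 2%Z, mask6 [:: 0; 3]); (2%Z, mask6 [:: 1; 4]);
                (2%Z, mask6 [:: 2; 5])]);
    (vX (2, 2), [:: (2%Z, mask6 [:: 0; 3]); (- 2%Z, mask6 [:: 1; 4]);
                (2%Z, mask6 [:: 2; 5])]);
    (vq (0, 0), [:: (1%Z, mask6 [:: 0; 1; 2])]);
    (vq (0, 1), [:: (2%Z, mask6 [:: 0; 1; 4])]);
    (vq (0, 2), [:: (- 2%Z, mask6 [:: 0; 1; 3])]);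
    (vq (0, 3), [:: (- 2%Z, mask6 [:: 0; 2; 3])]);
    (vq (1, 1), [:: (4%Z, mask6 [:: 0; 4; 5])]);
    (vq (1, 2), [:: (- 4%Z, mask6 [:: 0; 3; 5])]);
    (vq (1, 3), [:: (4%Z, mask6 [:: 0; 3; 4])]);
    (vq (2, 2), [:: (- 4%Z, mask6 [:: 1; 3; 5])]);
    (vq (2, 3), [:: (4%Z, mask6 [:: 1; 3; 4])]);
    (vq (3, 3), [:: (4%Z, mask6 [:: 2; 3; 4])])].

Definition lookup (k : eqType) (T : Type) (t : seq (k * seq T)) (a : k) : seq T :=
  flatten [seq m.2 | m <- t & m.1 == a].

Definition phiT (b : mask) : seq (int * (var * nat)) :=
  fmap (fun v => (v, 0%N)) (lookup phi_table b).

(** Outside the table, degrees at least 3 are filled in by duality. Eight monomials of degree 3,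
    those containing exactly one of each pair xi_i, eta_i, are fixed by [starm]. Four have sign +1
    and are listed; the others have sign -1, so their coefficient vanishes on the image, in
    agreement with the empty sum obtained here. *)
Definition phiF (b : mask) : seq (int * (var * nat)) :=
  if phiT b is [::] then
    if (3 <= count id b)%N
    then fscale (A_sgn b) (lder (count id b - 3) (phiT (starm b))) else [::]
  else phiT b.

Definition psiF (v : var) : seq (int * mask) := lookup psi_table v.

Definition vars : seq var := map fst psi_table.

(* Eliminates the coordinates that are determined by the others. *)
Definition redv (a : var * nat) : seq (int * (var * nat)) :=
  match a.1 with
  | inl (inr k) => if k == (3, 3)%N
      then [:: (- 1%Z, (vX (0, 0), a.2)); (- 1%Z, (vX (1, 1), a.2));
               (- 1%Z, (vX (2, 2), a.2))]
      else [:: (1%Z, a)]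
  | inr (inl k) => [:: (1%Z, (vq (minn k.1 k.2, maxn k.1 k.2), a.2))]
  | inr (inr c) => if (size c == 4) && (count id c != 2) then [::] else [:: (1%Z, a)]
  | _ => [:: (1%Z, a)]
  end.

Definition redb (b : seq (int * ((var * nat) * (var * nat)))) :=
  fbind b (fun a => ftens (redv a.1) (redv a.2)).

(** Each side is 8 times a coordinate: on the left 2 from [phiF] and 4 from [ebrF], on the right 2
    from each of the two factors and the explicit 2. *)
Definition bracket_check (b : mask) : bool :=
  feq (redb (fbind (phiF b) (fun a => iter a.2 (@bder _ _) (ebrF a.1))))
      (redb (fscale 2 (fbind (kbrF b) (fun a =>
        ftens (lder a.1.2 (phiF a.1.1)) (lder a.2.2 (phiF a.2.1)))))).

(* Twice the coordinate g_b of an element g of the image, in a normal form. *)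
Definition symF (b : mask) : seq (int * (mask * nat)) :=
  if (count id b < 3)%N then [:: (2%Z, (b, 0%N))]
  else if count id b == 3 then [:: (1%Z, (b, 0%N)); (A_sgn b, (starm b, 0%N))]
  else [:: (2 * A_sgn b, (starm b, (count id b - 3)%N))].
Definition nrmF (l : seq (int * (mask * nat))) :=
  fbind l (fun a => lder a.2 (symF a.1)).

Definition psi_phiF (b : mask) : seq (int * (mask * nat)) :=
  fbind (phiF b) (fun a => fmap (fun c => (c, a.2)) (psiF a.1)).

(** The factor 8 is 4 from [psiF] times 2 from [phiF]. The comparison is made after [nrmF] because
    phi after psi is the identity only on solutions of the duality equations. *)
Definition surj_check (b : mask) : bool :=
  all (fun m => size m.2.1 == 6) (psi_phiF b) &&
  feq (nrmF (psi_phiF b)) (nrmF [:: (8%Z, (b, 0%N))]).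

Definition inj_check (v : var) : bool :=
  all (fun m => size m.2 == 6) (psiF v) &&
  feq (fbind (psiF v) phiF) [:: (8%Z, (v, 0%N))].

(** The independent coordinates: [redv] leaves them unchanged, and their values can be prescribed
    freely. *)
Definition normal_var (v : var) : bool :=
  match v with
  | inl (inl _) => true
  | inl (inr k) => [&& k.1 < 4, k.2 < 4 & k != (3, 3)]%N
  | inr (inl k) => [&& k.1 <= k.2, k.1 < 4 & k.2 < 4]%N
  | inr (inr c) => (size c == 4) && (count id c == 2)
  end.

Definition pairs4 : seq (nat * nat) := [seq (i, j) | i <- iota 0 4, j <- iota 0 4].
Definition all_vars : seq var :=
  vW :: map vX pairs4 ++ map vq pairs4 ++ map vw (masks 4).

Definition dual_check (b : mask) : bool :=
  [&& A_sgn b * A_sgn (starm b) == 1, starm (starm b) == b,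
      count id (starm b) == (6 - count id b)%N &
      (3 <= count id b)%N ==>
      feq (phiF b) (fscale (A_sgn b) (lder (count id b - 3) (phiF (starm b))))].

Definition var_odd (v : var) : bool := if v is inr _ then true else false.

Definition parity_check (b : mask) : bool :=
  all (fun a => (a.2.1 \in vars) && vok a.2.1 && (var_odd a.2.1 == odd (count id b)))
      (phiF b).

(** * Finite verifications by evaluation *)

Lemma dual_checks : all dual_check (masks 6).
Proof. by vm_compute. Qed.
Lemma parity_checks : all parity_check (masks 6).
Proof. by vm_compute. Qed.
Lemma surj_checks : all surj_check (masks 6).
Proof. by vm_compute. Qed.
Lemma inj_checks : all inj_check vars.
Proof. by vm_compute. Qed.
Lemma bracket_checks : all bracket_check (masks 6).
Proof. by vm_compute. Qed.

Lemma size_checks : all (fun b => all (fun m =>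
  (size m.2.1.1 == 6) && (size m.2.2.1 == 6)) (kbrF b)) (masks 6).
Proof. by vm_compute. Qed.

Lemma normal_checks : all normal_var vars.
Proof. by vm_compute. Qed.
Lemma all_vars_checks :
  all (fun v => all (fun m => m.2.1 \in vars) (redv (v, 0%N))) all_vars.
Proof. by vm_compute. Qed.

(** * The operator A in coordinates and the duality equations *)

Section OperatorA.
Variable K : numFieldType.
Local Notation Lambda := {ffun {set 'I_6} -> K^o}.

Lemma masks_check (P : pred mask) b : all P (masks 6) -> size b = 6 -> P b.
Proof. by move=> /allP h sb; apply: h; rewrite mem_masks sb. Qed.

(** Multiplying a sorted monomial on the left by x costs one sign for each smaller generator, which
    is the head term of [sinv]. *)
Lemma wedge_seq_inv (s : seq 'I_6) : uniq s ->
  wedge_seq K^o s = (-1) ^+ sinv (map val s) *: mon K^o [set j in s].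
Proof.
elim: s => [|x s IH] /=.
  by move=> _; rewrite scale1r; congr mon; apply/setP => j; rewrite !inE.
move=> /andP[xs us]; rewrite IH // wedgeZr wedge_monmon; last first.
  by rewrite disjoints1 inE.
rewrite scalerA mulrC -exprD; congr (_ ^+ (_ + _) *: mon _ _); last first.
  by apply/setP => j; rewrite !inE.
rewrite /ninv big_set1 count_map -size_filter -(card_uniqP (filter_uniq _ us)).
by apply: eq_card => j; rewrite !inE mem_filter andbC.
Qed.

Lemma val_bar (j : 'I_6) : val (bar j) = ((j + 3) %% 6)%N.
Proof.
case: j => [] [|[|[|[|[|[|//]]]]]] lt;
  by rewrite /bar; case: splitP => -[] [|[|[|//]]].
Qed.

Lemma nth_barm (c : mask) (j : 'I_6) : size c = 6 ->
  nth false (barm c) j = nth false c (bar j).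
Proof.
case: c => [|c0 [|c1 [|c2 [|c3 [|c4 [|c5 [|//]]]]]]] // _.
by rewrite val_bar; case: j => [] [|[|[|[|[|[|//]]]]]].
Qed.

Lemma st_negb (c : mask) : size c = 6 -> set_of_mask 6 (map negb c) = ~: set_of_mask 6 c.
Proof.
by move=> sc; apply/setP => j; rewrite !inE (nth_map false) // sc.
Qed.

Lemma enum_st (c : mask) :
  map val (enum (set_of_mask 6 c)) = [seq i <- iota 0 6 | nth false c i].
Proof.
rewrite -(val_enum_ord 6) filter_map enumT; congr map.
by rewrite {1}/enum_mem; apply: eq_filter => i; rewrite /= inE.
Qed.

Lemma size_barm (c : mask) : size c = 6 -> size (barm c) = 6.
Proof. by move=> sc; rewrite size_cat size_drop size_take sc. Qed.

Lemma sharp_enum (c : mask) : size c = 6 ->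
  sharp K (enum (set_of_mask 6 c)) =
  (sharp_sgn c)%:~R *: mon K^o (set_of_mask 6 (map negb (barm c))).
Proof.
move=> sc; have sb := size_barm sc; rewrite /sharp.
have -> : [set j in map bar (enum (set_of_mask 6 c))] = set_of_mask 6 (barm c).
  apply/setP => j; rewrite !inE nth_barm // -[X in X \in _]barK.
  by rewrite (mem_map (inv_inj barK)) mem_enum inE.
rewrite -st_negb // wedge_seq_inv; last first.
  by rewrite (map_inj_uniq (inv_inj barK)) enum_uniq.
have -> : map val (map bar (enum (set_of_mask 6 c))) =
    [seq ((i + 3) %% 6)%N | i <- iota 0 6 & nth false c i].
  by rewrite -enum_st -!map_comp; apply: eq_map => j; rewrite /= val_bar.
have -> : [set j in map bar (enum (set_of_mask 6 c))] = set_of_mask 6 (barm c).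
  apply/setP => j; rewrite !inE nth_barm // -[X in X \in _]barK.
  by rewrite (mem_map (inv_inj barK)) mem_enum inE.
rewrite wedgeZl wedge_monmon; last by rewrite st_negb // -setI_eq0 setICr.
rewrite st_negb // setUCr -st_negb // ninv_st /lvol wedge_seq_inv //.
have -> : [set j in [:: xi 1; xi 2; Defs.eta 0; Defs.eta 1; Defs.eta 2; xi 0]] = setT.
  by apply/setP => j; rewrite !inE -!val_eqE /=; case: j; do 6!case=> //.
rewrite !ffunE eqxx /sharp_sgn sgnzE !exprD; congr (_ *: _).
by rewrite /GRing.scale /= !mulr1.
Qed.

Lemma sgnAE k : sgnA K k = (sgnz ((k * k.+1)./2))%:~R.
Proof. by rewrite sgnzE. Qed.

Lemma dual_checkP (b : mask) : size b = 6 -> dual_check b.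
Proof. exact: masks_check dual_checks. Qed.

Lemma starmK (b : mask) : size b = 6 -> starm (starm b) = b.
Proof. by move=> /dual_checkP /and4P[_ /eqP]. Qed.

Lemma size_starm (b : mask) : size b = 6 -> size (starm b) = 6.
Proof. by move=> sb; rewrite size_map size_barm. Qed.

Lemma count_starm (b : mask) : size b = 6 -> count id (starm b) = (6 - count id b)%N.
Proof. by move=> /dual_checkP /and4P[_ _ /eqP]. Qed.

Lemma A_sgnK (b : mask) : size b = 6 -> A_sgn b * A_sgn (starm b) = 1.
Proof. by move=> /dual_checkP /and4P[/eqP]. Qed.

(** Since [starm] is an involution, exactly one summand of [k16_A] reaches a given monomial. *)
Lemma kco_A (f : K16 K) (b : mask) : size b = 6 ->
  kco (k16_A f) b = (A_sgn b)%:~R *: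
    tder_pow (3%:Z - (count id (starm b))%:Z) (kco f (starm b)).
Proof.
move=> sb; apply/funext => n; rewrite /kco /k16_A sum_ffunE sum_masks.
have hs : starm b \in masks 6 by rewrite mem_masks size_starm.
rewrite (bigD1_seq (starm b)) ?masks_uniq // big1_seq ?addr0; last first.
  move=> c /andP[nc]; rewrite mem_masks => /eqP sc.
  rewrite ffunE sharp_enum // !ffunE; case: eqP => [e|]; last first.
    by rewrite /GRing.scale /= !mulr0.
  have e' : b = starm c.
    by rewrite -(set_of_maskK sb) e set_of_maskK // size_starm.
  by rewrite e' starmK ?eqxx in nc.
rewrite ffunE sharp_enum ?size_starm // !ffunE -/(starm _) starmK // eqxx.
rewrite card_st ?size_starm // sgnAE /A_sgn intrM fctE /GRing.scale /= mulr1.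
by rewrite [LHS]addr0 mulrAC.
Qed.

(** Here k is the degree of the target, so the source has degree 6 - k and the exponent 3 - (6 - k)
    is k - 3. *)
Lemma tder_pow_pos (f : nat -> K^o) k : (3 <= k <= 6)%N ->
  tder_pow (3%:Z - (6 - k)%N%:Z) f = iter (k - 3) (@tder K K^o) f.
Proof. by case: k => [|[|[|[|[|[|[|]]]]]]]. Qed.

Lemma tder_pow_neg (f : nat -> K^o) k : (3 <= k <= 6)%N ->
  tder_pow (3%:Z - k%:Z) f = iter (k - 3) (@tint K K^o) f.
Proof. by case: k => [|[|[|[|[|[|[|]]]]]]]. Qed.

Lemma tder_tint (f : nat -> K^o) : tder (tint f) = f.
Proof.
apply/funext => n; rewrite /tder /tint /= scalerA divff ?scale1r //.
by rewrite pnatr_eq0.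
Qed.

Lemma iter_tder_tint m (f : nat -> K^o) :
  iter m (@tder K K^o) (iter m (@tint K K^o) f) = f.
Proof.
elim: m f => //= m IH f; rewrite -[tint _]/(iter m.+1 _ _) iterSr.
by rewrite -iterS iterSr /= -[RHS]IH; congr iter; rewrite -iterSr /= tder_tint.
Qed.

Lemma count_le (b : mask) : size b = 6 -> (count id b <= 6)%N.
Proof. by move=> sb; have := count_size id b; rewrite sb. Qed.

(** The coefficient at [starm b] is f there plus a sign times the (k-3)-fold integral of f at b. Its
    (k-3)-th derivative no longer contains integrals, and as the two signs multiply to 1 it is the
    coefficient at b up to sign. *)
Lemma kco_iota_dual (f : K16 K) (b : mask) : size b = 6 -> (3 <= count id b)%N ->
  kco (k16_iota f) b =
  (A_sgn b)%:~R *: iter (count id b - 3) (@tder K K^o) (kco (k16_iota f) (starm b)).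
Proof.
move=> sb hb; have ss := size_starm sb; have h6 := count_le sb.
rewrite /k16_iota !kcoD !kco_A // starmK // count_starm //.
rewrite tder_pow_pos ?hb // tder_pow_neg ?hb //.
rewrite [kco f (starm b) + _]addrC iter_tderP iter_tder_tint scalerDr scalerA.
by rewrite -intrM A_sgnK // scale1r.
Qed.

End OperatorA.

(** * The map phi and its compatibility with the brackets *)

Section Isomorphism.
Variable K : numFieldType.

Lemma iter_tder0 d : iter d (@tder K K^o) 0 = 0.
Proof. by elim: d => //= d ->; rewrite tder0. Qed.

Lemma iter_tderZ d c f : iter d (@tder K K^o) (c *: f) = c *: iter d (@tder K K^o) f.
Proof. by elim: d => //= d ->; rewrite tderZ. Qed.

Local Notation Lambda := {ffun {set 'I_6} -> K^o}.
Local Notation poly := {mpoly K[4]}.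
Local Notation ser := (nat -> K^o).

Definition phi (x : E16 K) : K16 K := fun n =>
  [ffun S : {set 'I_6} =>
     (2%:R^-1 * feval (sere (eco x)) (phiF (mask_of_set S)) n : K^o)].

Lemma kco_phi x b : size b = 6 ->
  kco (phi x) b = 2%:R^-1 *: feval (sere (eco x)) (phiF b).
Proof. by move=> sb; apply/funext => n; rewrite /kco ffunE set_of_maskK. Qed.

Lemma phi_linear : linear phi.
Proof.
move=> a x y; apply: kco_inj => b sb; rewrite kcoD kcoZ !kco_phi //.
rewrite (@eq_feval _ _ _ _ (fun v => a *: sere (eco x) v + sere (eco y) v)).
  by rewrite feval_linear scalerDr !scalerA mulrC.
by move=> v; rewrite /sere eco_linear iter_tderP.
Qed.

HB.instance Definition _ :=
  GRing.isLinear.Build K (E16 K) (K16 K) _ phi phi_linear.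

Lemma vf_sum_xco (X : sl4 K) :
  \sum_(k <- iota 0 4) Xco (k, k) X = 0.
Proof.
have := congr1 (mcoeff 0%MM) (sl4_div X); rewrite mcoeff0 raddf_sum => h.
rewrite -[RHS]h -(@big_ord_iota 4 _ _ _ (fun k => Xco (k, k) X)).
by apply: eq_bigr => j _; rewrite /Xco /xco /= !inord_val.
Qed.

(** Three relations justify the eliminations: elements of sl_4 have zero divergence, partial
    derivatives commute, and a 2-form has no component outside degree 2. *)
Lemma redvE (x : E16 K) a : feval (sere (eco x)) (redv a) = sere (eco x) a.
Proof.
case: a => [[[[]|k]|[k|c]] d] /=; rewrite /redv /=.
- by rewrite feval_cons feval_nil addr0 scale1r.
- case: eqP => [->|_]; last by rewrite feval_cons feval_nil addr0 scale1r.
  rewrite !feval_cons feval_nil addr0 /sere /=.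
  have -> : cser (Xco (3, 3)%N) x.1.2 = (-1) *: cser (Xco (0, 0)%N) x.1.2 +
     ((-1) *: cser (Xco (1, 1)%N) x.1.2 + (-1) *: cser (Xco (2, 2)%N) x.1.2).
    apply/funext => n; rewrite !fctE /cser.
    have := vf_sum_xco (x.1.2 n); rewrite !big_cons big_nil addr0 => h.
    rewrite -[LHS]subr0 -[X in _ - X]h /GRing.scale /=; ring.
  by rewrite !iter_tderP iter_tderZ.
- rewrite feval_cons feval_nil addr0 scale1r /sere /=; congr iter.
  apply/funext => n; rewrite /cser; case: k => i j /=; case: leqP => // _.
  by rewrite /Qco /qco mderiv_comm.
case: ifP => [/andP[/eqP sc nc]|_]; last by rewrite feval_cons feval_nil addr0 scale1r.
rewrite feval_nil /sere /=.
have -> : cser (Wco c) x.2.2 = 0.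
  apply/funext => n; rewrite /cser /= /Wco /wco.
  have -> : L2_form (x.2.2 n) (set_of_mask 4 c) = 0; last by rewrite mcoeff0.
  by apply: (is_form_deg (L2_formP _)); rewrite card_st.
by rewrite iter_tder0.
Qed.

Lemma redbE (x y : E16 K) b :
  feval (bile (eco x) (eco y)) (redb b) = feval (bile (eco x) (eco y)) b.
Proof.
by rewrite feval_bind; apply: eq_feval => a; rewrite bile_tens !redvE.
Qed.

Lemma parity_checkP b m : size b = 6 -> m \in phiF b ->
  [/\ m.2.1 \in vars, vok m.2.1 & var_odd m.2.1 = odd (count id b)].
Proof.
move=> sb; have := masks_check parity_checks sb; rewrite /parity_check => /allP h.
by move=> /h /andP[/andP[h1 h2] /eqP h3]; split.
Qed.

Lemma kco_phi2 x b : size b = 6 ->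
  feval (sere (eco x)) (phiF b) = 2%:R *: kco (phi x) b.
Proof. by move=> sb; rewrite kco_phi // scalerA divff ?scale1r // pnatr_eq0. Qed.

Lemma phi_bracket x y : phi (e16_bracket x y) = k16_bracket (phi x) (phi y).
Proof.
apply: kco_inj => b sb; rewrite kco_bracket.
have e8 : (8%:R : K) != 0 by rewrite pnatr_eq0.
apply: (scalerI e8).
transitivity (feval (bile (eco x) (eco y))
    (fbind (phiF b) (fun a => iter a.2 (@bder _ _) (ebrF a.1)))).
  rewrite feval_bind
    (@eq_feval_seq _ _ _ _ (fun a => 4%:R *: sere (eco (e16_bracket x y)) a)).
    rewrite feval_scalel kco_phi2 // scalerA; congr (_ *: _); ring.
  by move=> m /(parity_checkP sb)[_ hm _]; rewrite iter_bderE -eco_bracket // iter_tderZ.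
have := masks_check bracket_checks sb; rewrite /bracket_check.
move=> /(feqP (bile (eco x) (eco y))) hb.
(* The two formal sums agree only modulo the relations among the coordinates, so the computed
   identity is used between their reduced forms. *)
rewrite -redbE hb redbE feval_scale feval_bind.
rewrite (@eq_feval_seq _ _ _ _ (fun a => 4%:R *: bile (kco (phi x)) (kco (phi y)) a)).
  rewrite feval_scalel scalerA; congr (_ *: _); ring.
have /allP hs : all (fun m => (size m.2.1.1 == 6) && (size m.2.2.1 == 6)) (kbrF b).
  exact: (masks_check size_checks sb).
move=> m /hs /andP[/eqP s1 /eqP s2].
rewrite bile_tens !lderE !kco_phi2 // !iter_tderZ smulZl smulZr scalerA.
by congr (_ *: _); ring.
Qed.

(** * Elements of E(1,6) are separated by their coordinates *)

Lemma homog1_ext (p q : poly) : p \is 1.-homog -> q \is 1.-homog ->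
  (forall i, p^`M(i)@_0%MM = q^`M(i)@_0%MM) -> p = q.
Proof.
move=> hp hq h; apply/mpolyP => m.
have [/mdeg1P[i /eqP ->]|nm] := boolP (mdeg m == 1); last first.
  by rewrite (dhomog_nemf_coeff hp nm) (dhomog_nemf_coeff hq nm).
have := h i; rewrite !mcoeff_mderiv add0m mnm0E.
by rewrite !mulr1n.
Qed.

(** Every monomial of degree 2 contains some variable; differentiating along it multiplies the
    coefficient by a nonzero integer and reduces the claim to linear forms. *)
Lemma homog2_ext (p q : poly) : p \is 2.-homog -> q \is 2.-homog ->
  (forall i j, p^`M(i)^`M(j)@_0%MM = q^`M(i)^`M(j)@_0%MM) -> p = q.
Proof.
move=> hp hq h; apply/mpolyP => m.
have [dm|nm] := eqVneq (mdeg m) 2; last first.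
  by rewrite (dhomog_nemf_coeff hp nm) (dhomog_nemf_coeff hq nm).
have [i mi] : exists i, m i != 0%N.
  case: (pickP (fun i => m i != 0%N)) => [i hi|h0]; first by exists i.
  by move: dm; rewrite mdegE big1 // => i _; have /negbFE/eqP := h0 i.
have e : p^`M(i) = q^`M(i).
  by apply: homog1_ext => //; exact: mderiv_homog.
have := congr1 (mcoeff (m - U_(i))%MM) e; rewrite !mcoeff_mderiv submK; last first.
  by rewrite lep1mP.
rewrite -[p@_m *+ _]mulr_natr -[q@_m *+ _]mulr_natr => /mulIf; apply.
by rewrite pnatr_eq0.
Qed.

Lemma E16_ext (x y : E16 K) : (forall v, vok v -> eco x v = eco y v) -> x = y.
Proof.
case: x => [[f X] [p s]]; case: y => [[g Y] [q w]] h.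
have -> : f = g by exact: (h vW).
have -> : X = Y.
  apply/funext => n; apply: val_inj; apply/ffunP => j.
  have /forallP hX := sl4_linear (X n); have /forallP hY := sl4_linear (Y n).
  apply: homog1_ext => //.
  move=> i; have := congr1 (fun u => u n) (h (vX (i : nat, j : nat)) _).
  by rewrite /= /cser /= /Xco /xco /= !inord_val; apply; rewrite !ltn_ord.
have -> : p = q.
  apply/funext => n; apply: val_inj; apply: homog2_ext; try exact: S2_homog.
  move=> i j; have := congr1 (fun u => u n) (h (vq (i : nat, j : nat)) _).
  by rewrite /= /cser /= /Qco /qco /= !inord_val; apply; rewrite !ltn_ord.
have -> : s = w; last by [].
apply/funext => n; apply: val_inj; apply/ffunP => S; have [c sc ->] := set_of_maskP S.
have := congr1 (fun u => u n) (h (vw c) (introT eqP sc)).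
rewrite /= /cser /= /Wco /wco => e.
apply/mpolyP => m; have [->|nm] := eqVneq m 0%MM; first exact: e.
rewrite -mdeg_eq0 in nm.
rewrite (dhomog_nemf_coeff (is_form_homog _ (L2_formP (s n))) nm).
by rewrite (dhomog_nemf_coeff (is_form_homog _ (L2_formP (w n))) nm).
Qed.

(** * Elements of E(1,6) with prescribed coordinates *)

Lemma mderivXU (a b : 'I_4) : ('X_a : poly)^`M(b) = (a == b)%:R.
Proof.
rewrite mderivX mnm1E; case: eqP => [->|_]; last by rewrite scale0r.
by rewrite -{1}[U_(b)%MM]add0m addmK mpolyX0 scale1r.
Qed.

Lemma dhomogXU (a : 'I_4) : ('X_a : poly) \is 1.-homog.
Proof. by rewrite dhomogX /= mdeg1. Qed.

Definition tr0 (B : nat * nat -> K) (k : nat * nat) : K :=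
  if k == (3, 3)%N then - (B (0, 0)%N + B (1, 1)%N + B (2, 2)%N) else B k.

Definition vf_of_coef (B : nat * nat -> K) : {ffun 'I_4 -> poly} :=
  [ffun j : 'I_4 => \sum_(i < 4) tr0 B (i : nat, j : nat) *: 'X_i].

Lemma vf_of_coef_deriv B (i j : 'I_4) :
  (vf_of_coef B j)^`M(i) = tr0 B (i : nat, j : nat) *: 1.
Proof.
rewrite ffunE linear_sum (bigD1 i) //= big1 ?addr0 => [|a /negPf nai].
  by rewrite linearZ /= mderivXU eqxx.
by rewrite linearZ /= mderivXU nai scaler0.
Qed.

Lemma is_sl4_of_coef B : is_sl4 (vf_of_coef B).
Proof.
apply/andP; split.
  apply/forallP => j; rewrite ffunE; apply: rpred_sum => i _.
  by apply: rpredZ; exact: dhomogXU.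
apply/eqP; rewrite /vf_div; under eq_bigr do rewrite vf_of_coef_deriv.
rewrite -scaler_suml (@big_ord_iota 4 _ _ _ (fun j => tr0 B (j, j))).
by rewrite !big_cons big_nil /tr0 /= addr0 !addrA subrr scale0r.
Qed.

Definition sl4_of_coef B : sl4 K := Sl4 (is_sl4_of_coef B).

Lemma Xco_of_coef B k : vok (vX k) -> Xco k (sl4_of_coef B) = tr0 B k.
Proof.
move=> /ord_pair[i [j ->]]; rewrite /Xco /xco /= !inord_val vf_of_coef_deriv.
by rewrite mcoeffZ mcoeff1 eqxx mulr1.
Qed.

(** The factor 1/2 serves twice: each mixed product occurs in two orders, and the second derivative
    of a square is 2. *)
Definition quad_of_coef (Q : nat * nat -> K) : poly :=
  \sum_(a < 4) \sum_(b < 4)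
    (2%:R^-1 * Q (minn a b, maxn a b)) *: ('X_a * 'X_b).

Lemma quad_of_coef_homog Q : quad_of_coef Q \is 2.-homog.
Proof.
apply: rpred_sum => a _; apply: rpred_sum => b _; apply: rpredZ.
by apply: (@dhomogM _ _ _ 1 _ 1); exact: dhomogXU.
Qed.

Definition S2_of_coef Q : dhomog 4 K 2 := DHomog (quad_of_coef_homog Q).

Lemma Qco_of_coef Q k : vok (vq k) ->
  Qco k (S2_of_coef Q) = Q (minn k.1 k.2, maxn k.1 k.2).
Proof.
move=> /ord_pair[i [j ->]]; rewrite /Qco /qco /= !inord_val /quad_of_coef.
rewrite [_^`M(i)]linear_sum c0_deriv_sum.
pose G (a b : 'I_4) : K := 2%:R^-1 * Q (minn a b, maxn a b) *
  ((a == i)%:R * (b == j)%:R + (a == j)%:R * (b == i)%:R).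
transitivity (\sum_a \sum_b G a b).
  apply: eq_bigr => a _; rewrite /= [_^`M(i)]linear_sum c0_deriv_sum.
  apply: eq_bigr => b _; rewrite !linearZ /=; congr (_ * _).
  by rewrite deriv2_c0M ?dhomogXU // !mderivXU !rmorph_nat.
have dsum c (F : 'I_4 -> K) : \sum_a F a * (a == c)%:R = F c.
  rewrite (bigD1 c) //= eqxx mulr1 big1 ?addr0 // => a /negPf ->.
  by rewrite mulr0.
have GE a : \sum_b G a b = 2%:R^-1 * Q (minn a j, maxn a j) * (a == i)%:R
                         + 2%:R^-1 * Q (minn a i, maxn a i) * (a == j)%:R.
  rewrite /G; under eq_bigr do rewrite mulrDr !mulrA.
  by rewrite big_split /= !dsum.
under eq_bigr do rewrite GE.
by rewrite big_split /= !dsum [minn j i]minnC [maxn j i]maxnC; field.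
Qed.

Definition form_of_coef (C : mask -> K) : {ffun {set 'I_4} -> poly} :=
  [ffun S : {set 'I_4} => if #|S| == 2 then C (mask_of_set S) *: 1 else 0].

Lemma form_of_coef_form C : is_form 2 0 (form_of_coef C).
Proof.
apply/is_formP; split=> S cS; rewrite ffunE; last by rewrite (negPf cS).
by rewrite cS eqxx; apply: rpredZ; exact: dhomog1.
Qed.

Definition L2_of_coef C : L2 K := MkL2 (form_of_coef_form C).

Lemma Wco_of_coef C c : normal_var (vw c) -> Wco c (L2_of_coef C) = C c.
Proof.
move=> /andP[/eqP sc cc]; rewrite /Wco /wco ffunE card_st // cc set_of_maskK //.
by rewrite mcoeffZ mcoeff1 eqxx mulr1.
Qed.

(** * The inverse map and the image of phi *)

Definition psi (g : K16 K) : E16 K :=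
  let c v n := 4%:R^-1 * feval (kco g) (psiF v) n in
  ((fun n => c vW n, fun n => sl4_of_coef (fun k => c (vX k) n)),
   (fun n => S2_of_coef (fun k => c (vq k) n),
    fun n => L2_of_coef (fun m => c (vw m) n))).

Lemma eco_psi g v : normal_var v ->
  eco (psi g) v = 4%:R^-1 *: feval (kco g) (psiF v).
Proof.
case: v => [[[]|k]|[k|c]] hv; apply/funext => n; first by [].
- case/and3P: hv => h1 h2 /negPf h3.
  have h : vok (vX k) by rewrite /= h1 h2.
  rewrite [LHS](Xco_of_coef _ h) /tr0 ifF //; exact: h3.
- case/and3P: hv => h0 h1 h2; have h : vok (vq k) by rewrite /= h1 h2.
  by rewrite [LHS](Qco_of_coef _ h) (minn_idPl h0) (maxn_idPr h0) -surjective_pairing.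
by rewrite [LHS](Wco_of_coef _ hv).
Qed.

(** The differential equations that cut out the image of iota. In degree 3 no derivative is left and
    they express self-duality. *)
Definition dual (g : K16 K) : Prop := forall b : mask, size b = 6 ->
  (3 <= count id b)%N ->
  kco g b = (A_sgn b)%:~R *: iter (count id b - 3) (@tder K K^o) (kco g (starm b)).

(** In degree 3 neither b nor [starm b] is preferred, so the normal form is the sum of the two equal
    expressions; this is the origin of the factor 2. *)
Lemma symFE g b : dual g -> size b = 6 ->
  feval (sere (kco g)) (symF b) = 2%:R *: kco g b.
Proof.
move=> hg sb; rewrite /symF; case: ltnP => hb.
  by rewrite feval_cons feval_nil addr0.
case: eqP => e3; rewrite !feval_cons feval_nil addr0 /sere /=.
  have := hg b sb hb; rewrite e3 /= => <-.
  by rewrite scale1r -mulr2n scaler_nat.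
by rewrite (hg b sb hb) intrM scalerA.
Qed.

Lemma nrmFE g l : dual g -> all (fun m => size m.2.1 == 6) l ->
  feval (sere (kco g)) (nrmF l) = 2%:R *: feval (sere (kco g)) l.
Proof.
move=> hg /allP hl; rewrite feval_bind -feval_scalel; apply: eq_feval_seq => m.
by move=> /hl /eqP sm; rewrite lderE symFE // iter_tderZ.
Qed.

Lemma feval_iter_tder (k : Type) (e : k -> ser) d l :
  iter d (@tder K K^o) (feval e l) = feval (sere e) (fmap (fun c => (c, d)) l).
Proof.
elim: l => [|[c a] l IH]; first by rewrite !feval_nil iter_tder0.
by rewrite feval_cons iter_tderP IH feval_cons.
Qed.

Lemma vars_normal v : v \in vars -> normal_var v.
Proof. exact: (allP normal_checks). Qed.

Lemma phi_psi g : dual g -> phi (psi g) = g.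
Proof.
move=> hg; apply: kco_inj => b sb.
have := masks_check surj_checks sb; rewrite /surj_check => /andP[hs].
move=> /(feqP (sere (kco g))); rewrite !nrmFE //=; last by rewrite sb.
rewrite feval_cons feval_nil addr0 scalerA /psi_phiF feval_bind.
rewrite (@eq_feval_seq _ _ _ _ (fun a => 4%:R *: sere (eco (psi g)) a)).
  rewrite feval_scalel kco_phi2 // !scalerA => e.
  (* Here 8 comes from [surj_check] and 2 from the normal form [nrmF]. *)
  have e16 : (2 * 8%:~R : K) != 0 by rewrite mulf_neq0 // pnatr_eq0.
  by apply: (scalerI e16); rewrite -[RHS]e; congr (_ *: _); ring.
move=> m /(parity_checkP sb)[/vars_normal hm _ _].
rewrite -feval_iter_tder /sere eco_psi // iter_tderZ scalerA divff ?scale1r //.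
by rewrite pnatr_eq0.
Qed.

Lemma eco_phi x v : v \in vars ->
  8%:R *: eco x v = feval (fun c => 2%:R *: kco (phi x) c) (psiF v).
Proof.
move=> hv; have := allP inj_checks v hv; rewrite /inj_check => /andP[/allP hs].
move=> /(feqP (sere (eco x))); rewrite feval_cons feval_nil addr0 feval_bind => e.
rewrite -[LHS]e; apply: eq_feval_seq => m /hs /eqP sm.
by rewrite kco_phi2.
Qed.

Lemma mem_all_vars v : vok v -> v \in all_vars.
Proof.
have p4 (k : nat * nat) : (k.1 < 4)%N && (k.2 < 4)%N -> k \in pairs4.
  by case: k => i j /andP[/= hi hj]; apply/allpairsP; exists (i, j); rewrite !mem_iota.
rewrite /all_vars inE !mem_cat.
case: v => [[[]|k]|[k|c]] hv //; apply/or4P.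
- by apply: Or42; apply: map_f; exact: p4.
- by apply: Or43; apply: map_f; exact: p4.
by apply: Or44; apply: map_f; rewrite mem_masks.
Qed.

(** The inverse table recovers the coordinates in [vars], and [redv] expresses all others through
    them. *)
Lemma phi_inj : injective phi.
Proof.
move=> x y e; have h v : v \in vars -> eco x v = eco y v.
  move=> hv; have e8 : (8%:R : K) != 0 by rewrite pnatr_eq0.
  by apply: (scalerI e8); rewrite !eco_phi // e.
apply: E16_ext => v hv.
rewrite -[eco x v]/(sere (eco x) (v, 0%N)) -[eco y v]/(sere (eco y) (v, 0%N)).
rewrite -!redvE; apply: eq_feval_seq => m.
have /allP hm := allP all_vars_checks v (mem_all_vars hv).
by move=> /hm /h; rewrite /sere => ->.
Qed.

Lemma phi_dual x : dual (phi x).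
Proof.
move=> b sb hb; have ss := size_starm sb.
have := dual_checkP sb; rewrite /dual_check => /and4P[_ _ _].
rewrite hb /= => /(feqP (sere (eco x))).
rewrite feval_scale lderE !kco_phi2 // iter_tderZ scalerA mulrC -scalerA.
by apply: scalerI; rewrite pnatr_eq0.
Qed.

Lemma phi_iota x : exists f, phi x = k16_iota f.
Proof.
(* The preimage keeps degrees below 3, half of degree 3, and nothing above. Then no integral
   survives in A(f): the operator restores the other half of degree 3 and, by differentiation, all
   higher degrees. *)
pose c (k : nat) : K := if (k < 3)%N then 1 else if k == 3 then 2%:R^-1 else 0.
pose f : K16 K := fun n => [ffun S : {set 'I_6} => (c #|S| * phi x n S : K^o)].
have kf b : size b = 6 -> kco f b = c (count id b) *: kco (phi x) b.
  by move=> sb; apply/funext => n; rewrite /kco ffunE card_st.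
exists f; apply: kco_inj => b sb; have ss := size_starm sb; have h6 := count_le sb.
rewrite /k16_iota kcoD kco_A // !kf // count_starm // tder_powZ.
have [hb|hb] := ltnP (count id b) 3.
  have -> : c (6 - count id b)%N = 0.
    by move: hb; rewrite /c; case: (count id b) => [|[|[|]]].
  by rewrite scale0r scaler0 addr0 /c hb scale1r.
rewrite tder_pow_pos ?hb // scalerA mulrC -scalerA -phi_dual // -scalerDl.
suff -> : c (count id b) + c (6 - count id b)%N = 1 by rewrite scale1r.
move: hb h6; rewrite /c; case: (count id b) => [|[|[|[|[|[|[|]]]]]]] //= _ _.
all: by rewrite ?add0r //; field.
Qed.

(** By [parity_check], monomials of odd degree involve only coordinates of the odd part, which
    vanish here. *)
Lemma phi_even x : e16_even x -> k16_even (phi x).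
Proof.
move=> hx n S oS; have [b sb eS] := set_of_maskP S; rewrite eS card_st // in oS *.
rewrite -[phi x n _]/(kco (phi x) b n) kco_phi // (@eq_feval_seq _ _ _ _ (fun=> 0)).
  by rewrite feval0 scaler0.
move=> m /(parity_checkP sb)[_ _]; rewrite oS /sere => hm.
rewrite (_ : eco x m.2.1 = 0) ?iter_tder0 //; move: m.2.1 hm.
by case=> [//|[k|c]] _; rewrite /= hx; apply/funext => i; rewrite /cser linear0.
Qed.

Lemma phi_odd x : e16_odd x -> k16_odd (phi x).
Proof.
move=> hx n S oS; have [b sb eS] := set_of_maskP S; rewrite eS card_st // in oS *.
rewrite -[phi x n _]/(kco (phi x) b n) kco_phi // (@eq_feval_seq _ _ _ _ (fun=> 0)).
  by rewrite feval0 scaler0.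
move=> m /(parity_checkP sb)[_ _]; rewrite (negPf oS) /sere => hm.
rewrite (_ : eco x m.2.1 = 0) ?iter_tder0 //; move: m.2.1 hm.
case=> [[u|k]|//] _; rewrite /= hx; first by [].
by apply/funext => i; rewrite /cser linear0.
Qed.

End Isomorphism.

Theorem theorem4p6 (R : realType) :
  is_subsuperalgebra (@k16_even R[i]) (@k16_odd R[i]) (@k16_bracket R[i])
    (@k16_iota_image R[i]) /\
  isomorphic_to_sub (@e16_even R[i]) (@e16_odd R[i]) (@e16_bracket R[i])
    (@k16_even R[i]) (@k16_odd R[i]) (@k16_bracket R[i])
    (@k16_iota_image R[i]).
Proof.
(* The images of iota and phi coincide: every iota(f) solves the duality equations, and on their
   solutions [psi] supplies a preimage under phi. All closure properties are then transported from
   E(1,6). *)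
have imP (g : K16 R[i]) : k16_iota_image g <-> exists x, g = phi x.
  split=> [[f ->]|[x ->]]; last exact: phi_iota.
  exists (psi (k16_iota f)); rewrite phi_psi // => b sb hb.
  exact: kco_iota_dual.
split; last first.
  exists (@phi R[i]); split=> [|//|||]; [exact: phi_inj|exact: phi_even|exact: phi_odd|].
  exact: phi_bracket.
split.
- by apply/imP; exists 0; rewrite linear0.
- move=> a _ _ /imP[x ->] /imP[y ->]; apply/imP; exists (a *: x + y).
  by rewrite linearP.
- move=> _ /imP[x ->]; exists (phi (x.1, 0)), (phi (0, x.2)); split.
  + by apply/imP; exists (x.1, 0).
  + exact: phi_even.
  + by apply/imP; exists (0, x.2).
  + exact: phi_odd.
  rewrite -linearD; congr phi; case: x => [a b]; apply: injective_projections => /=.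
    by rewrite addr0.
  by rewrite add0r.
- move=> _ _ /imP[x ->] /imP[y ->]; apply/imP; exists (e16_bracket x y).
  by rewrite phi_bracket.
Qed.
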